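(* Let $1\le k<m$ be integers. Let $E\subset A(m,k)$ be a non-empty collection of non-vertical affine subspaces such that $B=\bigcup_{P\in E}P\subset\mathbb{R}^m$ is Borel. Then for $\mathcal{L}^k$-almost all $t\in\mathbb{R}^k$, $\dim B_t\ge r(E)$, where $$r(E)=\inf\{\dim B'-k:\ B'\subset\mathbb{R}^m\text{ such that }\mathcal{H}^k(B'\cap P)>0\text{ for each }P\in E\}.$$
   Context: $\dim$ denotes Hausdorff dimension, $\mathcal{H}^k$ the $k$-dimensional Hausdorff measure, $\mathcal{L}^k$ Lebesgue measure on $\mathbb{R}^k$. $A(m,k)$ is the space of all $k$-dimensional affine subspaces of $\mathbb{R}^m$. Write $\mathbb{R}^m=\mathbb{R}^k\times\mathbb{R}^{m-k}$; $P\in A(m,k)$ is non-vertical if its orthogonal projection to $\mathbb{R}^k\times\{0\}$ is all of $\mathbb{R}^k\times\{0\}$. For $t\in\mathbb{R}^k$, $B_t=\{x\in\mathbb{R}^{m-k}:(t,x)\in B\}$. *)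

(* Defs.v *)
From mathcomp Require Import all_boot all_order all_algebra.
From mathcomp Require Import all_classical all_reals all_analysis.

Set Implicit Arguments.
Unset Strict Implicit.
Unset Printing Implicit Defensive.

Import Order.TTheory GRing.Theory Num.Theory.
Import numFieldNormedType.Exports.

Local Open Scope classical_set_scope.
Local Open Scope ring_scope.

(* The canonical norm on ['rV[R]_n] is the sup norm, hence an explicit
   Euclidean distance. *)
Definition edist (R : realType) (n : nat) (x y : 'rV[R]_n) : R :=
  Num.sqrt (\sum_(i < n) (x ord0 i - y ord0 i) ^+ 2).

(* [maxe 0] only serves to give the empty set diameter 0 (not -oo). *)
Definition diam (R : realType) (n : nat) (A : set 'rV[R]_n) : \bar R :=
  maxe 0%E (ereal_sup [set (edist x y)%:E | x in A & y in A]).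

(* [diam A ^ s], with [diam A ^ 0 = 1] for every nonempty [A], and the empty
   set contributing 0 for every [s]. *)
Definition hausdorff_gauge (R : realType) (n : nat) (s : R)
    (A : set 'rV[R]_n) : \bar R :=
  if `[< A = set0 >] then 0%E else poweR (diam A) s.

Definition hausdorff_premeasure (R : realType) (n : nat) (s delta : R)
    (A : set 'rV[R]_n) : \bar R :=
  ereal_inf [set (\sum_(0 <= i <oo) hausdorff_gauge s (U i))%E |
    U in [set U : nat -> set 'rV[R]_n |
      (forall i, (diam (U i) <= delta%:E)%E) /\ A `<=` \bigcup_i U i]].

(* Outer measure, defined on all subsets, without a normalizing constant (only
   its vanishing or positivity is used). *)
Definition hausdorff_measure (R : realType) (n : nat) (s : R)
    (A : set 'rV[R]_n) : \bar R :=
  ereal_sup [set hausdorff_premeasure s delta A |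
    delta in [set delta : R | 0 < delta]].

Definition hausdorff_dim (R : realType) (n : nat) (A : set 'rV[R]_n) : \bar R :=
  ereal_inf [set s%:E | s in
    [set s : R | 0 <= s /\ hausdorff_measure s A = 0%E]].

(* [k]-dimensional Lebesgue outer measure ([0 < k]), by countable covers with
   closed boxes. *)
Definition lebesgue_outer (R : realType) (k : nat) (A : set 'rV[R]_k) :
    \bar R :=
  ereal_inf [set v | exists a b : nat -> 'rV[R]_k,
    [/\ forall i j, a i ord0 j <= b i ord0 j,
        A `<=` \bigcup_i
          [set x | forall j, a i ord0 j <= x ord0 j <= b i ord0 j] &
        v = (\sum_(0 <= i <oo)
               (\prod_(j < k) (b i ord0 j - a i ord0 j))%:E)%E]].

Definition lebesgue_ae (R : realType) (k : nat) (Q : 'rV[R]_k -> Prop) : Prop :=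
  lebesgue_outer [set t | ~ Q t] = 0%E.

Definition borel (T : topologicalType) (B : set T) : Prop :=
  <<s [set U : set T | open U] >> B.

Definition affine_subspaces (R : realType) (m k : nat) : set (set 'rV[R]_m) :=
  [set P | exists (p : 'rV[R]_m) (V : {vspace 'rV[R]_m}),
     \dim V = k /\ P = [set p + v | v in [set` V]]].

(* R^(k + n) is identified with R^k x R^n through [row_mx]/[lsubmx]. *)
Definition horizontal_proj (R : realType) (k n : nat) (x : 'rV[R]_(k + n)) :
    'rV[R]_(k + n) :=
  row_mx (lsubmx x) 0.

Definition non_vertical (R : realType) (k n : nat) (P : set 'rV[R]_(k + n)) :
    Prop :=
  [set horizontal_proj x | x in P] = [set row_mx t 0 | t in [set: 'rV[R]_k]].

Definition slice (R : realType) (k n : nat) (B : set 'rV[R]_(k + n))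
    (t : 'rV[R]_k) : set 'rV[R]_n :=
  [set x | B (row_mx t x)].

Definition rdim (R : realType) (m k : nat) (E : set (set 'rV[R]_m)) : \bar R :=
  ereal_inf [set (hausdorff_dim B' - k%:R%:E)%E |
    B' in [set B' : set 'rV[R]_m |
      forall P, E P -> (0 < hausdorff_measure k%:R (B' `&` P))%E]].

(* Main.v *)
Require Import Defs.
From HB Require Import structures.
From mathcomp Require Import all_boot all_order all_algebra.
From mathcomp Require Import all_classical all_reals all_analysis.
From mathcomp Require Import ring lra zify.
Import Order.TTheory GRing.Theory Num.Theory.
Import numFieldNormedType.Exports.
Set Implicit Arguments.
Unset Strict Implicit.
Unset Printing Implicit Defensive.
Local Open Scope classical_set_scope.
Local Open Scope ring_scope.

(* Suppose that [dim B_t < q < q' < r(E)] for all [t] in a set [T] of positive outer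
   measure, and let [mu] be the restriction of the Lebesgue outer measure to a
   bounded part of [T].

   Step 1. For every scale there is a countable cover of [B] over [T] by products
   [U_Q x Q], with [U_Q] measurable and [Q] a dyadic cube of side [2^-j] below that
   scale, such that [sum mu(U_Q) 2^(-jq)] is arbitrarily small. The infimum of
   such sums is a capacity (dyadic cubes form a tree, which makes it continuous
   along increasing sequences), it vanishes on the compact sets whose sections
   over [T] are [H^q]-null, and Borel sets are capacitable.

   Step 2. Cut [R^k] into cells [D] of side [2^-j] and keep only the products
   [D x Q] with [mu(U_Q cap D) >= 2^(-jk) 2^(-j(q'-q))]. The kept products are few
   enough for their limit set [B'] (over covers of finer and finer scale) to have
   dimension at most [k + q']. A Lipschitz graph meets boundedly many [Q] over each
   [D], so a Borel-Cantelli argument shows that the graph of every affine map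
   contained in [B] lies in [B'] over almost all of [T].

   As every [P] in [E] is such a graph, [B'] meets every [P] in a set of positive
   [H^k] measure, whence [r(E) <= q'], a contradiction. *)

Local Notation edist := Defs.edist.

(** * Outer measures defined by countable covers *)

Section cover_inf.
Context (R : realType) (T I : Type) (w : I -> \bar R) (C : I -> set T).
Hypothesis w0 : forall i, (0 <= w i)%E.

(** The Hausdorff premeasures and the Lebesgue outer measure are both of this form, with [I] a type
    of admissible pieces, so that countable subadditivity is proved once. *)
Definition cover_inf (A : set T) : \bar R :=
  ereal_inf [set (\sum_(0 <= i <oo) w (u i))%E |
    u in [set u : nat -> I | A `<=` \bigcup_i C (u i)]].

Lemma cover_inf_ge0 A : (0 <= cover_inf A)%E.
Proof. by apply: le_ereal_inf_tmp => _ [u _ <-]; apply: nneseries_ge0. Qed.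

Lemma le_cover_inf : {homo cover_inf : A B / A `<=` B >-> (A <= B)%E}.
Proof.
move=> A B AB; apply: ereal_inf_le_tmp => _ [u Bu <-].
by exists u => //; exact: subset_trans Bu.
Qed.

Variable i0 : I.
Hypothesis wi0 : w i0 = 0%E.

(** Decoding natural numbers turns the family into a sequence; numbers that code nothing receive the
    weightless piece [i0]. *)
Lemma cover_inf_le_esum (K : countType) (c : K -> I) (A : set T) :
  A `<=` \bigcup_k C (c k) ->
  (cover_inf A <= \esum_(k in [set: K]) w (c k))%E.
Proof.
move=> Ac; pose u (n : nat) := if @pickle_inv K n is Some k then c k else i0.
apply: (@le_trans _ _ (\sum_(0 <= n <oo) w (u n))%E).
  apply: ereal_inf_lbound; exists u => // x /Ac[k _ Cx].
  by exists (pickle k) => //; rewrite /u pickleK_inv.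
rewrite nneseries_esumT //.
rewrite (_ : (\esum_(n in setT) w (u n))%E =
    (\esum_(n in [set pickle k | k in [set: K]]) w (u n))%E); last first.
  rewrite [RHS]esum_mkcond; apply: eq_esum => n _; case: ifPn => //.
  rewrite notin_setE /= => nK; rewrite /u.
  case: (@pickle_inv K n) (@pickle_invK K n) => //= k kn.
  by exfalso; apply: nK; exists k.
rewrite (@esum_image _ _ _ _ (@pickle K) (fun n => w (u n))); last exact: in2W (pcan_inj pickleK).
by apply: le_esum => k _; rewrite /u pickleK_inv.
Qed.

Lemma cover_inf_sigma_subadditive : sigma_subadditive cover_inf.
Proof.
move=> F; have [[n Fn]|finF] := pselect (exists n, cover_inf (F n) = +oo%E).
  rewrite [leRHS](eseries_pinfty _ _ Fn) ?leey // => i _.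
  by rewrite gt_eqF // (lt_le_trans _ (cover_inf_ge0 _)).
apply/lee_addgt0Pr => e e0.
apply: (le_trans _ (epsilon_trick xpredT (fun n => cover_inf_ge0 (F n)) (ltW e0))).
have /choice[u Hu] : forall n, exists u : nat -> I, F n `<=` \bigcup_i C (u i) /\
    (\sum_(0 <= i <oo) w (u i) <= cover_inf (F n) + (e / (2 ^ n.+1)%:R)%:E)%E.
  move=> n; have en : 0 < e / (2 ^ n.+1)%:R by rewrite divr_gt0 // ltr0n expn_gt0.
  have fin : cover_inf (F n) \is a fin_num.
    rewrite ge0_fin_numE ?cover_inf_ge0 // ltey; apply/eqP => Fn.
    by apply: finF; exists n.
  have [_ [u Fu <-] lu] := lb_ereal_inf_adherent en fin.
  by exists u; split=> //; exact: ltW.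
apply: (@le_trans _ _ (\sum_(0 <= n <oo) \sum_(0 <= i <oo) w (u n i))%E); last first.
  by apply: lee_nneseries => [n _ _|n _]; [exact: nneseries_ge0|exact: (Hu n).2].
rewrite nneseries_esumT; last by move=> n; exact: nneseries_ge0.
under eq_esum do rewrite nneseries_esumT //.
rewrite esum_esum //.
apply: (le_trans (cover_inf_le_esum (c := fun p : nat * nat => u p.1 p.2) _)).
  move=> x [n _ /(Hu n).1[i _ Cx]]; by exists (n, i).
by rewrite le_eqVlt; apply/predU1P; left; congr esum; apply/seteqP; split.
Qed.

End cover_inf.

(** * Hausdorff premeasures and null sets *)

Section hausdorff.
Context (R : realType) (n : nat).
Implicit Types (A U : set 'rV[R]_n) (s : R).

Lemma diam_ge0 A : (0 <= diam A)%E.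
Proof. by rewrite /diam le_max lexx. Qed.

Lemma edist_le_diam A (x y : 'rV[R]_n) : A x -> A y -> ((edist x y)%:E <= diam A)%E.
Proof.
move=> Ax Ay; rewrite /diam le_max; apply/orP; right.
by apply: ereal_sup_ubound; exists x => //; exists y.
Qed.

Lemma diam_set0 : diam (set0 : set 'rV[R]_n) = 0%E.
Proof.
rewrite /diam (_ : [set _ | _ in _ & _ in _] = set0) ?ereal_sup0.
  by apply/max_idPl; exact: leNye.
by apply/seteqP; split=> // z [x []].
Qed.

Lemma diam_le A (d : R) : 0 <= d -> (forall x y, A x -> A y -> edist x y <= d) ->
  (diam A <= d%:E)%E.
Proof.
move=> d0 Ad; rewrite /diam ge_max lee_fin d0 /=; apply: ge_ereal_sup => _ [x Ax [y Ay <-]].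
by rewrite lee_fin; exact: Ad.
Qed.

Lemma coord_le_edist (x y : 'rV[R]_n) i : `|x ord0 i - y ord0 i| <= edist x y.
Proof.
rewrite -sqrtr_sqr /edist ler_wsqrtr // (bigD1 i) //= lerDl.
by apply: sumr_ge0 => j _; exact: sqr_ge0.
Qed.

Lemma edist_le_coord (x y : 'rV[R]_n) (d : R) : 0 <= d ->
  (forall i, `|x ord0 i - y ord0 i| <= d) -> edist x y <= Num.sqrt n%:R * d.
Proof.
move=> d0 H; rewrite -[X in _ * X](ger0_norm d0) -sqrtr_sqr -sqrtrM ?ler0n //.
rewrite /edist ler_wsqrtr // -[n in n%:R]card_ord -sumr_const mulr_suml.
apply: ler_sum => i _; rewrite mul1r -[leLHS]real_normK ?num_real //.
by rewrite ler_sqr ?nnegrE.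
Qed.

Lemma gauge_ge0 s A : (0 <= hausdorff_gauge s A)%E.
Proof. by rewrite /hausdorff_gauge; case: ifP => // _; exact: poweR_ge0. Qed.

Lemma gauge_set0 s : hausdorff_gauge s (set0 : set 'rV[R]_n) = 0%E.
Proof. by rewrite /hausdorff_gauge ifT //; apply/asboolP. Qed.

Lemma gauge_le s A (d : R) : 0 <= s -> (diam A <= d%:E)%E ->
  (hausdorff_gauge s A <= (d `^ s)%:E)%E.
Proof.
move=> s0 Ad; rewrite /hausdorff_gauge; case: ifP => _; first by rewrite lee_fin powR_ge0.
rewrite -poweR_EFin.
have d0 := le_trans (diam_ge0 A) Ad.
by apply: gt0_ler_poweR => //; rewrite in_itv /= ?diam_ge0 ?d0 leey.
Qed.

Let J (delta : R) := {U : set 'rV[R]_n | (diam U <= delta%:E)%E}.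

Lemma premeasureE s delta : hausdorff_premeasure s delta =
  cover_inf (fun p : J delta => hausdorff_gauge s (sval p)) sval.
Proof.
apply/funext => A; congr ereal_inf; apply/seteqP; split=> v [].
  by move=> U [Ud AU] <-; exists (fun i => exist _ (U i) (Ud i)).
move=> u Au <-; exists (fun i => sval (u i)) => //; split=> // i.
exact: (svalP (u i)).
Qed.

Let i0 delta (d0 : 0 < delta) : J delta.
Proof. by exists set0; rewrite diam_set0 lee_fin ltW. Defined.

Lemma premeasure_ge0 s delta A : (0 <= hausdorff_premeasure s delta A)%E.
Proof. by rewrite premeasureE; apply: cover_inf_ge0 => U; exact: gauge_ge0. Qed.

Lemma le_premeasure s delta A B : A `<=` B ->
  (hausdorff_premeasure s delta A <= hausdorff_premeasure s delta B)%E.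
Proof. by move=> AB; rewrite premeasureE; exact: le_cover_inf. Qed.

Lemma premeasure_le_esum s delta (K : countType) (c : K -> set 'rV[R]_n) A :
  0 < delta -> (forall k, (diam (c k) <= delta%:E)%E) -> A `<=` \bigcup_k c k ->
  (hausdorff_premeasure s delta A <= \esum_(k in [set: K]) hausdorff_gauge s (c k))%E.
Proof.
move=> d0 cd Ac; rewrite premeasureE.
have := @cover_inf_le_esum R _ (J delta) (fun p => hausdorff_gauge s (sval p)) sval
  (fun p => gauge_ge0 s (sval p)) (i0 d0) (gauge_set0 s) K
  (fun k => exist _ (c k) (cd k)) A.
exact.
Qed.

Lemma hausdorff_measure_ge0 s A : (0 <= hausdorff_measure s A)%E.
Proof.
apply: le_trans (premeasure_ge0 s 1 A) _; apply: ereal_sup_ubound.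
by exists 1 => //=.
Qed.

Lemma hausdorff_null s A : hausdorff_measure s A = 0%E <->
  forall delta, 0 < delta -> hausdorff_premeasure s delta A = 0%E.
Proof.
split=> [H delta d0|H]; apply/eqP; rewrite eq_le ?premeasure_ge0 ?hausdorff_measure_ge0 andbT.
  by rewrite -H; apply: ereal_sup_ubound; exists delta.
by apply: ge_ereal_sup => _ [delta d0 <-]; rewrite H.
Qed.

Lemma hausdorff_null_bigcup s (A : nat -> set 'rV[R]_n) :
  (forall i, hausdorff_measure s (A i) = 0%E) ->
  hausdorff_measure s (\bigcup_i A i) = 0%E.
Proof.
move=> HA; apply/hausdorff_null => delta d0; apply/eqP.
rewrite eq_le premeasure_ge0 andbT.
have := @cover_inf_sigma_subadditive R _ (J delta) (fun p => hausdorff_gauge s (sval p))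
  sval (fun p => gauge_ge0 s (sval p)) (i0 d0) (gauge_set0 s) A.
rewrite -premeasureE => /le_trans; apply.
by rewrite eseries0 // => i _ _; move/hausdorff_null : (HA i) => /(_ _ d0).
Qed.

End hausdorff.

(** [S] is an arbitrary set, because the exceptional set of parameters is not known to be
    measurable. The restriction is still an outer measure, and sets measurable for [mu] remain
    measurable for it. *)
Definition outer_restr (R : realType) (T : Type)
  (mu : {outer_measure set T -> \bar R}) (S A : set T) : \bar R := mu (A `&` S).

Section outer_restr.
Context (R : realType) (T : Type) (mu : {outer_measure set T -> \bar R}) (S : set T).

Let restr0 : outer_restr mu S set0 = 0%E.
Proof. by rewrite /outer_restr set0I. Qed.

Let restr_ge0 A : (0 <= outer_restr mu S A)%E.
Proof. exact: outer_measure_ge0. Qed.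

Let le_restr : {homo outer_restr mu S : A B / A `<=` B >-> (A <= B)%E}.
Proof. by move=> A B AB; apply: le_outer_measure; exact: setSI. Qed.

Let restr_subadditive : sigma_subadditive (outer_restr mu S).
Proof. by move=> F; rewrite /outer_restr setI_bigcupl; exact: outer_measure_sigma_subadditive. Qed.

HB.instance Definition _ := isOuterMeasure.Build R T (outer_restr mu S)
  restr0 restr_ge0 le_restr restr_subadditive.

Lemma outer_restr_caratheodory A : mu.-caratheodory A ->
  (outer_restr mu S).-caratheodory A.
Proof. by move=> mA X; rewrite /outer_restr (mA (X `&` S)) setIAC (setIAC X S). Qed.

End outer_restr.

(** * Lebesgue outer measure *)

Section lebesgue.
Context (R : realType) (k : nat).
Implicit Types (x : 'rV[R]_k.+1) (A : set 'rV[R]_k.+1).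

Let J := {p : 'rV[R]_k.+1 * 'rV[R]_k.+1 | forall j, p.1 ord0 j <= p.2 ord0 j}.
Let box (p : J) : set 'rV[R]_k.+1 :=
  [set x | forall j, (sval p).1 ord0 j <= x ord0 j <= (sval p).2 ord0 j].
Let vol (p : J) : \bar R :=
  (\prod_(j < k.+1) ((sval p).2 ord0 j - (sval p).1 ord0 j))%:E.

Let vol_ge0 p : (0 <= vol p)%E.
Proof. by rewrite lee_fin; apply: prodr_ge0 => j _; rewrite subr_ge0; exact: (svalP p). Qed.

Let p0 : J. Proof. by exists (0, 0) => j /=. Defined.

(** A point has volume 0 only in positive dimension: in dimension 0 the empty product would be 1. *)
Let vol_p0 : vol p0 = 0%E.
Proof. by rewrite /vol big_ord_recl /= !mxE subrr mul0r. Qed.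

Let lebesgue_outerE : @lebesgue_outer R k.+1 = cover_inf vol box.
Proof.
apply/funext => A; congr ereal_inf; apply/seteqP; split=> v.
  move=> [a [b [ab Aab ->]]].
  by exists (fun i => exist _ (a i, b i) (ab i)).
move=> [u Au <-]; exists (fun i => (sval (u i)).1), (fun i => (sval (u i)).2); split=> //.
by move=> i; exact: (svalP (u i)).
Qed.

Let lebesgue0 : lebesgue_outer (set0 : set 'rV[R]_k.+1) = 0%E.
Proof.
rewrite lebesgue_outerE; apply/eqP; rewrite eq_le cover_inf_ge0 // andbT.
apply: ereal_inf_lbound; exists (fun=> p0) => //.
by rewrite eseries0 // => i _ _; rewrite vol_p0.
Qed.

Let lebesgue_ge0 A : (0 <= lebesgue_outer A)%E.
Proof. by rewrite lebesgue_outerE cover_inf_ge0. Qed.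

Let le_lebesgue : {homo @lebesgue_outer R k.+1 : A B / A `<=` B >-> (A <= B)%E}.
Proof. by rewrite lebesgue_outerE; exact: le_cover_inf. Qed.

Let lebesgue_subadditive : sigma_subadditive (@lebesgue_outer R k.+1).
Proof. by rewrite lebesgue_outerE; exact: cover_inf_sigma_subadditive vol_p0. Qed.

HB.instance Definition _ := isOuterMeasure.Build R _ (@lebesgue_outer R k.+1)
  lebesgue0 lebesgue_ge0 le_lebesgue lebesgue_subadditive.

Lemma lebesgue_outer_bounded (r : R) : 0 <= r ->
  (lebesgue_outer [set x : 'rV[R]_k.+1 | forall j, (`|x ord0 j| <= r)%R] < +oo)%E.
Proof.
move=> r0; have Hp j : (const_mx (- r) : 'rV[R]_k.+1) ord0 j <= (const_mx r : 'rV[R]_k.+1) ord0 j.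
  by rewrite !mxE; lra.
pose p : J := exist _ (const_mx (- r), const_mx r) Hp.
rewrite lebesgue_outerE.
apply: (@le_lt_trans _ _ (\esum_(i in [set: unit]) vol p)%E).
  apply: (cover_inf_le_esum vol_ge0 vol_p0 (c := fun=> p)) => x /= xr.
  by exists tt => // j /=; rewrite !mxE -ler_norml.
rewrite (_ : [set: unit] = [set tt]) ?esum_set1 ?ltry //.
by apply/seteqP; split=> [[]|].
Qed.

(** A hyperplane orthogonal to an axis cuts every box into two boxes whose volumes add up, so a
    cover of [X] splits into covers of its two parts without changing the total volume. *)
Lemma halfspace_caratheodory (j : 'I_k.+1) (c : R) :
  (@lebesgue_outer R k.+1).-caratheodory [set x : 'rV[R]_k.+1 | x ord0 j < c].
Proof.
apply: le_caratheodory_measurable => X; rewrite /= lebesgue_outerE.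
apply: le_ereal_inf_tmp => _ [u Xu <-].
(* The cut [c] is clamped to the box, so that a box lying on one side of the hyperplane gets a
   degenerate second half. *)
pose cl (p : J) := Num.min (Num.max c ((sval p).1 ord0 j)) ((sval p).2 ord0 j).
have cl_ge (p : J) : (sval p).1 ord0 j <= cl p by rewrite le_min le_max lexx orbT (svalP p).
have cl_le (p : J) : cl p <= (sval p).2 ord0 j by rewrite ge_min lexx orbT.
pose setj (x : 'rV[R]_k.+1) (d : R) : 'rV[R]_k.+1 :=
  \row_i (if i == j then d else x ord0 i).
have Hlo (p : J) i : (sval p).1 ord0 i <= setj (sval p).2 (cl p) ord0 i.
  by rewrite mxE; case: eqP => [->//|_]; exact: (svalP p).
have Hhi (p : J) i : setj (sval p).1 (cl p) ord0 i <= (sval p).2 ord0 i.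
  by rewrite mxE; case: eqP => [->//|_]; exact: (svalP p).
pose lo (p : J) : J := exist _ ((sval p).1, setj (sval p).2 (cl p)) (Hlo p).
pose hi (p : J) : J := exist _ (setj (sval p).1 (cl p), (sval p).2) (Hhi p).
have volE (p : J) : vol p = (vol (lo p) + vol (hi p))%E.
  rewrite /vol -EFinD; congr (_%:E).
  rewrite (bigD1 j) //= [X in _ = X + _](bigD1 j) //= [X in _ = _ + X](bigD1 j) //=.
  rewrite !mxE eqxx.
  under [X in _ = _ * X + _]eq_bigr => i ij do rewrite mxE (negPf ij).
  under [X in _ = _ + _ * X]eq_bigr => i ij do rewrite mxE (negPf ij).
  by rewrite -mulrDl; congr (_ * _); lra.
under eq_eseriesr do rewrite volE.
rewrite nneseriesD //; apply: leeD; apply: ereal_inf_lbound.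
- exists (lo \o u) => // x [/Xu[i _ xi] /= xc]; exists i => // l /=.
  rewrite mxE; have := xi l; case: eqP => [->|_] //.
  move=> /andP[ax xb]; rewrite ax /= le_min xb andbT le_max.
  by rewrite (ltW xc).
- exists (hi \o u) => // x [/Xu[i _ xi] /= /negP]; rewrite -leNgt => xc.
  exists i => // l /=; rewrite mxE; have := xi l; case: eqP => [->|_] //.
  move=> /andP[ax xb]; rewrite xb andbT ge_min; apply/orP; left.
  by rewrite ge_max xc.
Qed.

End lebesgue.

(** * Souslin sets *)

(** The Souslin operation on a scheme of closed sets, which need not decrease along branches. *)
Definition souslin (X : topologicalType) (A : set X) : Prop :=
  exists F : seq nat -> set X, (forall u, closed (F u)) /\
    forall x, A x <-> exists s : nat -> nat, forall j, F (mkseq s j) x.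

Lemma souslin_closed (X : topologicalType) (A : set X) : closed A -> souslin A.
Proof.
move=> cA; exists (fun=> A); split=> // x; split=> [Ax|[s /(_ 0%N)]//].
by exists (fun=> 0%N).
Qed.

Lemma mkseq_cons (T : Type) (f : nat -> T) j :
  mkseq f j.+1 = f 0%N :: mkseq (f \o succn) j.
Proof. by rewrite /mkseq /= -[iota 1 j]/(iota (1 + 0) j) iotaDl -map_comp. Qed.

Lemma souslin_bigcup (X : topologicalType) (A : nat -> set X) :
  (forall i, souslin (A i)) -> souslin (\bigcup_i A i).
Proof.
move=> /choice[F FA].
pose G (u : seq nat) := if u is i :: v then F i v else setT.
exists G; split.
  by move=> [|i v]; [exact: closedT|exact: (FA i).1].
move=> x; split=> [[i _ /(FA i).2[s Hs]]|[s Hs]].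
  exists (fun j => if j is l.+1 then s l else i) => -[|j]; first exact: I.
  by rewrite mkseq_cons; exact: Hs.
exists (s 0%N) => //; apply/(FA _).2; exists (s \o succn) => j.
by move: (Hs j.+1); rewrite mkseq_cons.
Qed.

(** One sequence encodes, through a pairing, a witnessing branch for every [A i]. A prefix [u] of it
    constrains a point only through the initial segments that can be read off entirely from [u],
    which is what [known] expresses; this leaves an intersection of closed sets. *)
Lemma souslin_bigcap (X : topologicalType) (A : nat -> set X) :
  (forall i, souslin (A i)) -> souslin (\bigcap_i A i).
Proof.
move=> /choice[F FA]; pose cd (i a : nat) : nat := pickle (i, a).
pose row (u : seq nat) i j := mkseq (fun a => nth 0%N u (cd i a)) j.
pose known (u : seq nat) i j := forall a, (a < j)%N -> (cd i a < size u)%N.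
exists (fun u => [set x | forall i j, known u i j -> F i (row u i j) x]).
split=> [u|x].
  rewrite (_ : [set x | _] = \bigcap_(i in setT)
      \bigcap_(j in [set j | known u i j]) F i (row u i j)).
    by apply: closed_bigI => i _; apply: closed_bigI => j _; exact: (FA i).1.
  by apply/seteqP; split=> [y h i _ j|y h i j kn]; [exact: h|exact: h].
split=> [|[s Hs] i _].
  move=> Ax; have /choice[t Ht] : forall i, exists s, forall j, F i (mkseq s j) x.
    by move=> i; exact/(FA i).2/Ax.
  pose s m := if @unpickle (nat * nat)%type m is Some ia then t ia.1 ia.2 else 0%N.
  exists s => l i j kn.
  suff -> : row (mkseq s l) i j = mkseq (t i) j by exact: Ht.
  apply/eq_in_map => a; rewrite mem_iota add0n => /andP[_ aj].
  have := kn a aj; rewrite size_mkseq => cl.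
  by rewrite nth_mkseq // /s /cd pickleK.
apply/(FA i).2; exists (fun a => s (cd i a)) => j.
(* A prefix of this length reveals the first [j] entries of the [i]-th branch. *)
pose l := \max_(a < j) (cd i a).+1.
have kn : known (mkseq s l) i j.
  move=> a aj; rewrite size_mkseq /l.
  exact: (@leq_bigmax _ (fun a : 'I_j => (cd i a).+1) (Ordinal aj)).
have := Hs l i j kn; congr (F i _ x).
apply/eq_in_map => a; rewrite mem_iota add0n => /andP[_ aj].
by have := kn a aj; rewrite size_mkseq => cl; rewrite nth_mkseq.
Qed.

Lemma open_bigcup_closed (R : realType) (V : normedModType R) (U : set V) :
  open U -> exists C : nat -> set V, (forall i, closed (C i)) /\ U = \bigcup_i C i.
Proof.
move=> oU; exists (fun i => \bigcap_(y in ~` U) [set x : V | i.+1%:R^-1 <= `|x - y|]).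
split=> [i|].
  apply: closed_bigI => y _.
  apply: (@closed_comp _ _ (fun x : V => `|x - y|) [set z | i.+1%:R^-1 <= z]).
    by move=> x _; apply: cvg_norm; apply: cvgB; [exact: cvg_id|exact: cvg_cst].
  exact: closed_ge.
apply/seteqP; split=> [x Ux|x [i _ /= h]].
  have /nbhs_ballP[e /= e0 He] : nbhs x U by exact: open_nbhs_nbhs.
  have [i] := @ltr_add_invr R 0 e e0; rewrite add0r => ie.
  exists i => // y /= nUy; rewrite leNgt; apply/negP => xy; apply: nUy.
  by apply: He; rewrite -ball_normE /=; exact: lt_trans ie.
apply: contrapT => nU; have /= := h x nU.
by rewrite subrr normr0 leNgt invr_gt0 ltr0n.
Qed.

(** Souslin sets need not be stable under complement, but the sets that are Souslin together with
    their complement form a sigma-algebra; it contains the open sets, since these are countable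
    unions of closed sets. *)
Lemma borel_souslin (R : realType) (V : normedModType R) (B : set V) :
  borel B -> souslin B.
Proof.
pose S := [set A : set V | souslin A /\ souslin (~` A)].
move=> bB; suff [] : S B by [].
apply: bB; split.
  split=> [|A [? ?]|A SA].
  - by split; [exact/souslin_closed/closed0|rewrite setC0; exact/souslin_closed/closedT].
  - by rewrite setTD; split; rewrite ?setCK.
  - split; first by apply: souslin_bigcup => i; case: (SA i).
    by rewrite setC_bigcup; apply: souslin_bigcap => i; case: (SA i).
move=> U oU; split; last by apply: souslin_closed; rewrite closedC.
have [C [cC ->]] := open_bigcup_closed oU.
by apply: souslin_bigcup => i; exact/souslin_closed.
Qed.

(** * Content of families of dyadic cubes *)

Section node_content.
Context (R : realType) (T : pointedType) (L : finType).
Variables (mu : {outer_measure set T -> \bar R}) (w : nat -> R) (j0 : nat).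
Hypothesis w0 : forall j, 0 <= w j.
Implicit Types (A : T -> (nat -> L) -> Prop) (U V : seq L -> set T) (u : seq L).

(** [U u] is the set of parameters over which the node [u] is used. Banning short words forces all
    cubes below a given scale, and a code is covered as soon as one of its prefixes is used. *)
Definition node_cover A U : Prop :=
  [/\ forall u, (size u < j0)%N -> U u = set0,
      forall u, mu.-caratheodory (U u) &
      forall t c, A t c -> exists j, U (mkseq c j) t].

Definition cover_weight U : \bar R :=
  (\esum_(u in [set: seq L]) (w (size u))%:E * mu (U u))%E.

Definition node_content A : \bar R :=
  ereal_inf [set cover_weight U | U in node_cover A].

Let term_ge0 U u : (0 <= (w (size u))%:E * mu (U u))%E.
Proof. by rewrite mule_ge0 // ?lee_fin ?outer_measure_ge0. Qed.

Lemma node_content_ge0 A : (0 <= node_content A)%E.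
Proof. by apply: le_ereal_inf_tmp => _ [U _ <-]; apply: esum_ge0 => u _. Qed.

Lemma node_content_le A U : node_cover A U -> (node_content A <= cover_weight U)%E.
Proof. by move=> AU; apply: ereal_inf_lbound; exists U. Qed.

Lemma le_node_content A A' : (forall t c, A t c -> A' t c) ->
  (node_content A <= node_content A')%E.
Proof.
move=> AA'; apply: ereal_inf_le_tmp => _ [U [U0 mU cU] <-].
by exists U => //; split=> // t c /AA'; exact: cU.
Qed.

Lemma le_cover_weight U V : (forall u, U u `<=` V u) ->
  (cover_weight U <= cover_weight V)%E.
Proof.
move=> UV; apply: le_esum => u _; apply: lee_wpmul2l; first by rewrite lee_fin.
exact: le_outer_measure.
Qed.

Lemma caratheodory_modular (X Y : set T) : mu.-caratheodory X ->
  (mu (X `|` Y) + mu (X `&` Y) = mu X + mu Y)%E.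
Proof.
move=> mX; rewrite [mu (X `|` Y)]mX [in RHS](mX Y).
have -> : (X `|` Y) `&` X = X by rewrite setIC; exact/setIidPl/subsetUl.
have -> : (X `|` Y) `&` ~` X = Y `&` ~` X by rewrite setIUl setICr set0U.
by rewrite (setIC X Y) -addeA (addeC (mu (Y `&` ~` X))).
Qed.

(** Strong subadditivity of the weight, node by node: [mu] is modular on a pair with one measurable
    member, and the inclusions say that no parameter is counted more often at a node than before. *)
Lemma cover_weight_modular (U V U' V' : seq L -> set T) :
  (forall u, mu.-caratheodory (U u)) -> (forall u, mu.-caratheodory (U' u)) ->
  (forall u, U' u `|` V' u `<=` U u `|` V u) ->
  (forall u, U' u `&` V' u `<=` U u `&` V u) ->
  (cover_weight U' + cover_weight V' <= cover_weight U + cover_weight V)%E.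
Proof.
move=> mU mU' sU sI; rewrite /cover_weight -!esumD //; apply: le_esum => u _.
rewrite -!ge0_muleDr ?outer_measure_ge0 //.
apply: lee_wpmul2l; first by rewrite lee_fin.
rewrite -(caratheodory_modular (V' u) (mU' u)) -(caratheodory_modular (V u) (mU u)).
by apply: leeD; apply: le_outer_measure.
Qed.

Let above U u : set T := \bigcup_(i in [set i | (i < size u)%N]) U (take i u).

Let maximal U u : set T := U u `\` above U u.

(** A branch that meets both families meets [below U V] at the deeper of the two nodes, so
    [below U V] covers whatever both [U] and [V] cover. *)
Let below U V u : set T :=
  (U u `&` (V u `|` above V u)) `|` (V u `&` (U u `|` above U u)).

Let mabove U : (forall u, mu.-caratheodory (U u)) ->
  forall u, mu.-caratheodory (above U u).
Proof.
move=> mU u; rewrite /above bigcup_mkcond; apply: caratheodory_measurable_bigcup => i.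
by case: ifP => _ //; exact: caratheodory_measurable_set0.
Qed.

Let mmaximal U : (forall u, mu.-caratheodory (U u)) ->
  forall u, mu.-caratheodory (maximal U u).
Proof. by move=> mU u; apply: caratheodory_measurable_setD => //; exact: mabove. Qed.

Let mbelow U V : (forall u, mu.-caratheodory (U u)) ->
  (forall u, mu.-caratheodory (V u)) -> forall u, mu.-caratheodory (below U V u).
Proof.
move=> mU mV u; apply: caratheodory_measurable_setU;
  apply: caratheodory_measurable_setI => //;
  by apply: caratheodory_measurable_setU => //; exact: mabove.
Qed.

Let take_mkseq_lt (c : nat -> L) i j : (i <= j)%N -> take i (mkseq c j) = mkseq c i.
Proof. by move=> ij; rewrite /mkseq -map_take take_iota (minn_idPl ij). Qed.

Let maximal_cover A U : node_cover A U -> node_cover A (maximal U).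
Proof.
move=> [U0 mU cU]; split; [|exact: mmaximal|].
  by move=> u /U0 Uu; rewrite /maximal Uu set0D.
move=> t c /cU exU; have exU' : exists j, `[< U (mkseq c j) t >].
  by have [j Uj] := exU; exists j; apply/asboolP.
case: (ex_minnP exU') => j /asboolP Uj jmin; exists j; split=> // -[i /=].
rewrite size_mkseq => ij; rewrite take_mkseq_lt ?(ltnW ij) // => Ui.
by have := jmin i (introT (asboolP _) Ui); rewrite leqNgt ij.
Qed.

Let below_cover A U V : node_cover A U -> node_cover A V -> node_cover A (below U V).
Proof.
move=> [U0 mU cU] [V0 mV cV]; split; [|exact: mbelow|].
  by move=> u su; rewrite /below U0 // V0 // !set0I setU0.
move=> t c Atc; have [i Ui] := cU _ _ Atc; have [j Vj] := cV _ _ Atc.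
have [ij|ji|ij] := ltngtP i j.
- exists j; right; split=> //; right; exists i; rewrite /= ?size_mkseq //.
  by rewrite take_mkseq_lt // ltnW.
- exists i; left; split=> //; right; exists j; rewrite /= ?size_mkseq //.
  by rewrite take_mkseq_lt // ltnW.
- by exists i; left; split=> //; left; rewrite ij.
Qed.

(* If covers [U_i] of the sets [A_i] are nearly optimal, the maximal elements of
   [U_0, .., U_n] form a nearly optimal cover of [A_n]: passing from [n] to
   [n.+1] they and the family [below] together weigh at most what the
   two given covers do, and [below] still covers [A_n]. *)
Lemma node_content_bigcup (A : nat -> T -> (nat -> L) -> Prop) (a : R) :
  (forall v t c, A v t c -> A v.+1 t c) ->
  (forall v, (node_content (A v) <= a%:E)%E) ->
  (node_content (fun t c => exists v, A v t c) <= a%:E)%E.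
Proof.
move=> incA leA; apply/lee_addgt0Pr => e e0.
have finA v : node_content (A v) \is a fin_num.
  by rewrite ge0_fin_numE ?node_content_ge0 // (le_lt_trans (leA v)) ?ltry.
pose eps v := e * 2^-1 ^+ v.+1.
have eps0 v : 0 < eps v by rewrite mulr_gt0 // exprn_gt0 // invr_gt0.
have /choice[U HU] : forall v, exists U, node_cover (A v) U /\
    (cover_weight U <= node_content (A v) + (eps v)%:E)%E.
  move=> v; have [_ [U AU <-] lU] := lb_ereal_inf_adherent (eps0 v) (finA v).
  by exists U; split=> //; exact: ltW.
have mU v u : mu.-caratheodory (U v u) by case: (HU v) => -[].
pose X n u := \bigcup_(i in [set i | (i < n.+1)%N]) U i u.
have X0 n u : (size u < j0)%N -> X n u = set0.
  by move=> su; apply: bigcup0 => i _; case: (HU i) => -[->].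
have mX n u : mu.-caratheodory (X n u).
  rewrite /X bigcup_mkcond; apply: caratheodory_measurable_bigcup => i.
  by case: ifP => _ //; exact: caratheodory_measurable_set0.
have XS n u : X n.+1 u = X n u `|` U n.+1 u.
  apply/seteqP; split=> [t [i /= iS Ui]|t [[i /= iS Ui]|Ut]].
  - by move: iS; rewrite ltnS leq_eqVlt => /predU1P[<-|iS]; [right|left; exists i].
  - by exists i => //=; exact: ltnW.
  - by exists n.+1 => /=.
have XA n : node_cover (A n) (X n).
  split; [exact: X0|exact: mX|move=> t c].
  move=> /(let: And3 _ _ h := (HU n).1 in h t c)[j Uj].
  by exists j; exists n => /=.
pose M n := maximal (X n).
have MA n : node_cover (A n) (M n) by exact: maximal_cover.
have mM n u : mu.-caratheodory (M n u) by exact: mmaximal.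
(* The error term is the sum of [eps 0], .., [eps n]. *)
have wM n : (cover_weight (M n) <=
    node_content (A n) + (e * (1 - 2^-1 ^+ n.+1))%:E)%E.
  elim: n => [|n IH].
    apply: (@le_trans _ _ (cover_weight (U 0%N))).
      apply: le_cover_weight => u t [[i /= i0 Ui] _].
      by move: i0 Ui; rewrite ltnS leqn0 => /eqP ->.
    apply: (le_trans (HU 0%N).2); rewrite leeD2l // lee_fin /eps !expr1.
    by rewrite ler_pM2l //; lra.
  have AS : node_cover (A n) (U n.+1).
    have [[U0 mUn cU] _] := HU n.+1; split=> // t c /incA; exact: cU.
  have aboveX u t : above (X n) u t -> above (X n.+1) u t.
    by move=> [i iu Xi]; exists i => //; rewrite XS; left.
  have MX u t : M n.+1 u t -> ~ above (M n) u t /\ ~ above (U n.+1) u t.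
    move=> [_ nab]; split=> -[i iu Hi]; apply: nab; exists i => //; rewrite XS.
      by left; case: Hi.
    by right.
  have H : (cover_weight (M n.+1) + cover_weight (below (M n) (U n.+1)) <=
      cover_weight (M n) + cover_weight (U n.+1))%E.
    apply: cover_weight_modular => //.
    - move=> u t [[Xt nab]|[[Mt _]|[Ut _]]]; [|by left|by right].
      move: Xt; rewrite XS => -[Xt|]; [left|by right].
      by split=> // /aboveX.
    - move=> u t [Mt Bt]; have [nM nU] := MX u t Mt.
      by case: Bt => -[H1 [H2|//]].
  (* [below] covers [A n], hence weighs at least its content; being finite, this content then
     cancels with the one in the induction hypothesis. *)
  have {}H : (cover_weight (M n.+1) + node_content (A n) <=
     (node_content (A n) + (e * (1 - 2^-1 ^+ n.+1))%:E) +
     (node_content (A n.+1) + (eps n.+1)%:E))%E.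
    apply: (le_trans _ (leeD IH (HU n.+1).2)); apply: (le_trans _ H).
    by rewrite leeD2l //; exact: node_content_le (below_cover (MA n) AS).
  move: H; rewrite addeC -addeA leeD2lE // => /le_trans; apply.
  rewrite addeCA leeD2l // -EFinD lee_fin /eps -mulrDr ler_pM2l //.
  rewrite [_ ^+ n.+2]exprS; set z := _ ^+ n.+1; lra.
pose Xo u := \bigcup_n X n u.
have mXo u : mu.-caratheodory (Xo u) by exact: caratheodory_measurable_bigcup.
have XoA : node_cover (fun t c => exists v, A v t c) Xo.
  split=> [u su|//|t c [v Av]]; first by apply: bigcup0 => i _; exact: X0.
  have [_ _ /(_ _ _ Av)[j Xj]] := XA v.
  by exists j; exists v.
apply: (le_trans (node_content_le (maximal_cover XoA))).
apply: ge_ereal_sup => _ [F [finF _] <-]; rewrite fsbig_finite //=.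
set r := (X in (\sum_(u <- X) _ <= _)%E).
(* A node maximal in the union and already present at stage [n] is maximal in [X n], so [Z n] weighs
   at most as much as [M n]. As [Z n u] increases to [maximal Xo u], continuity from below carries
   the bound over to every finite sum. *)
pose Z n u := maximal Xo u `&` X n u.
have mZ n u : mu.-caratheodory (Z n u).
  by apply: caratheodory_measurable_setI => //; exact: mmaximal.
have cvgZ u : ((w (size u))%:E * mu (Z n u))%E @[n --> \oo] -->
    ((w (size u))%:E * mu (maximal Xo u))%E.
  apply: cvgeZl => //.
  have -> : maximal Xo u = \bigcup_n Z n u.
    apply/seteqP; split=> [t Mt|t [n _ []//]].
    by have [[n _ Xt] _] := Mt; exists n.
  have mZu : mu.-caratheodory (\bigcup_n Z n u).
    by apply: caratheodory_measurable_bigcup.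
  apply: (@nondecreasing_cvg_mu _ (caratheodory_type mu) R mu (Z^~ u));
    [by move=> i; exact: mZ|exact: mZu|].
  move=> m n mn; apply/subsetPset => t [Mt [i /= im Ui]]; split=> //.
  by exists i => //=; exact: leq_trans mn.
have cvgF : (\sum_(u <- r) (w (size u))%:E * mu (Z n u))%E @[n --> \oo]
    --> (\sum_(u <- r) (w (size u))%:E * mu (maximal Xo u))%E.
  by apply: cvg_nnesum => u _; [exact: nearW|exact: cvgZ].
apply: (cvge_le _ cvgF); apply: nearW => n; apply: (@le_trans _ _ (cover_weight (M n))).
  apply: (@le_trans _ _ (cover_weight (Z n))).
    by apply: ereal_sup_ubound; exists F => //; rewrite fsbig_finite.
  apply: le_cover_weight => u t [[_ nab] Xt]; split=> // -[i iu Xi].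
  by apply: nab; exists i => //; exists n.
apply: (le_trans (wM n)); apply: leeD; first exact: leA.
rewrite lee_fin ler_piMr ?(ltW e0) // gerBl exprn_ge0 // invr_ge0.
Qed.

End node_content.

(** * Capacitability *)

Lemma ultra_pigeonhole (I : Type) (K : eqType) (G : set_system I) (s : seq K)
    (f : I -> K) :
  UltraFilter G -> G [set i | f i \in s] -> exists2 v, v \in s & G [set i | f i = v].
Proof.
move=> UG; elim: s => [|v s IH] Gs.
  have /filter_ex[i //] : G set0 by apply: filterS Gs.
have [Gv|Gv] := in_ultra_setVsetC [set i | f i = v] UG.
  by exists v => //; exact: mem_head.
have [|v' v's Gv'] := IH.
  apply: filterS (filterI Gs Gv) => i /= [].
  by rewrite inE => /predU1P[->|//] /(_ erefl).
by exists v' => //; rewrite inE v's orbT.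
Qed.

Lemma ler_sum_subset (R : realDomainType) (K : eqType) (f : K -> R) (r s : seq K) :
  (forall x, 0 <= f x) -> uniq r -> {subset r <= s} ->
  \sum_(x <- r) f x <= \sum_(x <- s) f x.
Proof.
move=> f0 ur rs; apply: (@le_trans _ _ (\sum_(x <- s | x \in r) f x)); last first.
  by rewrite [leRHS](bigID (mem r)) /= -[leLHS]addr0 lerD ?sumr_ge0.
elim: s r ur rs => [|y s IH] r ur rs.
  by case: r ur rs => [|x r] _ rs; [rewrite !big_nil|have := rs x (mem_head _ _)].
have [yr|yr] := boolP (y \in r); rewrite big_cons ?yr ?(negPf yr) /=; last first.
  apply: IH => // x xr; have := rs x xr; rewrite inE => /predU1P[xy|//].
  by rewrite xy (negPf yr) in xr.
rewrite (big_rem y yr) /= lerD2l.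
apply: (@le_trans _ _ (\sum_(i <- s | i \in rem y r) f i)).
  apply: IH; first exact: rem_uniq.
  move=> x; rewrite mem_rem_uniq // inE => /andP[/negPf xy xr].
  by have := rs x xr; rewrite inE xy.
rewrite [leRHS](bigID (mem (rem y r))) /= -[leLHS]addr0 lerD ?sumr_ge0 //.
rewrite [leRHS](eq_bigl (mem (rem y r))) // => x /=.
by apply/andP/idP => [[]//|xr]; split=> //; exact: mem_rem xr.
Qed.

Section capacity.
Context (R : realType) (S : normedModType R) (X : topologicalType) (L : finType).
Variables (cube : seq L -> set X) (F : seq nat -> set (S * X)).
Hypothesis cube_closed : forall u, closed (cube u).
Hypothesis cube_compact : compact (cube [::]).
Hypothesis F_closed : forall u, closed (F u).

(* A point [x] on the boundary of cubes has several codes [c], and covers have to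
   meet all of them; in exchange the cylinders of codes are both open and compact. *)
Definition coded_section (hs : seq nat) (t : S) (c : nat -> L) : Prop :=
  exists x s, [/\ forall j, cube (mkseq c j) x, forall j, F (mkseq s j) (t, x) &
    forall i, (i < size hs)%N -> (s i <= nth 0%N hs i)%N].

(** Compactness: counterexamples for all [N], with radius [1 / (N + 1)], would have a limit. Their
    codes take values in a finite alphabet, their branches are bounded by [h], their points lie in
    the compact root cube, and all the sets are closed, so the limit is a code of the full section
    at [t0]. It has a prefix in some [Sq i], which nearby counterexamples share. *)
Lemma coded_section_tube (t0 : S) (h : nat -> nat) (Sq : nat -> seq (seq L)) :
  (forall c, coded_section [::] t0 c -> exists i j, mkseq c j \in Sq i) ->
  exists N, exists2 e : R, 0 < e & forall t, ball t0 e t ->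
    forall c, coded_section (mkseq h N) t c ->
      exists i j, (i < N)%N /\ mkseq c j \in Sq i.
Proof.
move=> cov; apply: contrapT => noN.
have /choice[p Hp] : forall N, exists p : S * X * (nat -> L) * (nat -> nat),
    let: (t, x, c, s) := p in
    [/\ ball t0 N.+1%:R^-1 t, forall j, cube (mkseq c j) x,
        forall j, F (mkseq s j) (t, x), forall i, (i < N)%N -> (s i <= h i)%N &
        forall i j, (i < N)%N -> mkseq c j \notin Sq i].
  move=> N; apply: contrapT => nop; apply: noN; exists N, N.+1%:R^-1.
    by rewrite invr_gt0 ltr0n.
  move=> t bt c [x [s [Hx Hs sh]]]; apply: contrapT => nij; apply: nop.
  exists (t, x, c, s); split=> // [i iN|i j iN].
    by have := sh i; rewrite size_mkseq nth_mkseq //; exact.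
  by apply/negP => cS; apply: nij; exists i, j.
pose t_ N := (p N).1.1.1; pose x_ N := (p N).1.1.2.
pose c_ N := (p N).1.2; pose s_ N := (p N).2.
have {}Hp N : [/\ ball t0 N.+1%:R^-1 (t_ N), forall j, cube (mkseq (c_ N) j) (x_ N),
        forall j, F (mkseq (s_ N) j) (t_ N, x_ N),
        forall i, (i < N)%N -> (s_ N i <= h i)%N &
        forall i j, (i < N)%N -> mkseq (c_ N) j \notin Sq i].
  by move: (Hp N); rewrite /t_ /x_ /c_ /s_; case: (p N) => -[[? ?] ?] ?.
(* A free ultrafilter replaces the diagonal extraction of subsequences. *)
have [G [UG ooG]] := ultraFilterLemma (eventually_filter : ProperFilter \oo).
have Glt i : G [set N | (i < N)%N] by apply: ooG; exists i.+1.
have /choice[c Hc] : forall l, exists v, G [set N | c_ N l = v].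
  move=> l; have [|v _ ?] := @ultra_pigeonhole _ _ G (enum L) (c_^~ l) UG; last by exists v.
  by apply: filterS (Glt 0%N) => N _ /=; rewrite mem_enum.
have /choice[s Hs] : forall l, exists v, G [set N | s_ N l = v].
  move=> l; have [|v _ ?] := @ultra_pigeonhole _ _ G (iota 0 (h l).+1) (s_^~ l) UG; last by exists v.
  apply: filterS (Glt l) => N lN; rewrite /mkset mem_iota leq0n add0n ltnS.
  by have [_ _ _ -> //] := Hp N.
have Gmk (K : Type) (f : nat -> nat -> K) (g : nat -> K) :
    (forall l, G [set N | f N l = g l]) -> forall j, G [set N | mkseq (f N) j = mkseq g j].
  move=> fg; elim=> [|j IH]; first by apply: filterS (Glt 0%N).
  by apply: filterS (filterI IH (fg j)) => N /= []; rewrite !mkseqS => -> ->.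
have Gcube : (x_ @ G) (cube [::]).
  change (G [set N | cube [::] (x_ N)]).
  by apply: filterS (Glt 0%N) => N _ /=; have [_ /(_ 0%N)] := Hp N.
have [x [_ clx]] := cube_compact _ Gcube.
have Gt e : 0 < e -> G [set N | ball t0 e (t_ N)].
  move=> e0; have [i] := @ltr_add_invr R 0 e e0; rewrite add0r => ie.
  apply: filterS (Glt i) => N /= iN; have [+ _ _ _ _] := Hp N.
  apply: le_ball; apply: le_trans (ltW ie).
  by rewrite lef_pV2 ?posrE ?ltr0n // ler_nat ltnS ltnW.
have limC (C : set (S * X)) : closed C -> G [set N | C (t_ N, x_ N)] -> C (t0, x).
  move=> cC GC; apply: cC => B [[B1 B2] /= [/nbhs_ballP[e /= e0 eB] nB2] B12].
  have [y [[N [CN tN] <-] By]] := clx (x_ @` [set N | C (t_ N, x_ N) /\ ball t0 e (t_ N)])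
    B2 (filterS (fun N HN => ex_intro2 _ _ N HN erefl) (filterI GC (Gt _ e0))) nB2.
  by exists (t_ N, x_ N); split=> //; apply: B12; split=> //=; exact: eB.
have /cov[i [j cS]] : coded_section [::] t0 c.
  exists x, s; split=> // j.
  - apply: (limC [set q | cube (mkseq c j) q.2]).
      apply: (@closed_comp _ _ snd (cube (mkseq c j))) => // q _; exact: cvg_snd.
    by apply: filterS (Gmk _ _ _ Hc j) => N /= <-; have [_ + _ _ _] := Hp N; exact.
  - apply: limC => //.
    by apply: filterS (Gmk _ _ _ Hs j) => N /= <-; have [_ _ + _ _] := Hp N; exact.
have GcN : G [set N | mkseq (c_ N) j = mkseq c j /\ (i < N)%N].
  exact: filterI (Gmk _ _ _ Hc j) (Glt i).
have [N [/= cN iN]] := filter_ex GcN.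
by have [_ _ _ _ /(_ i j iN)] := Hp N; rewrite cN cS.
Qed.

Variables (mu : {outer_measure set S -> \bar R}) (w : nat -> R) (j0 : nat) (T0 : set S).
Hypothesis w0 : forall j, 0 <= w j.
Hypothesis mu_fin : (mu setT < +oo)%E.
Hypothesis mu_open : forall U : set S, open U -> mu.-caratheodory U.
Hypothesis muT0 : mu (~` T0) = 0%E.
Hypothesis small_section : forall t, T0 t -> forall e, 0 < e ->
  exists Sq : nat -> seq (seq L), [/\ forall i u, u \in Sq i -> (j0 <= size u)%N,
    forall N, \sum_(i < N) \sum_(u <- Sq i) w (size u) <= e &
    forall c, coded_section [::] t c -> exists i j, mkseq c j \in Sq i].

Let mu_fin_num A : mu A \is a fin_num.
Proof.
rewrite ge0_fin_numE ?outer_measure_ge0 //; apply: le_lt_trans mu_fin.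
exact: le_outer_measure.
Qed.

Let m A := fine (mu A).

Let muE A : mu A = (m A)%:E. Proof. by rewrite fineK. Qed.

Let m_ge0 A : 0 <= m A. Proof. by rewrite fine_ge0 // outer_measure_ge0. Qed.

Section finite_cover.
Variables (h : nat -> nat) (e : R).
Hypothesis e0 : 0 < e.

(** Finite families of nodes are countably many, which lets a sequence of open sets exhaust [T0];
    invalid codes stand for the empty family. *)
Let fam (l : nat) : seq (seq L) :=
  if @unpickle (seq (seq L)) l is Some f then
    (if all (fun u => (j0 <= size u)%N) f && (\sum_(u <- f) w (size u) <= e)
     then f else [::]) else [::].

Let fam_size l u : u \in fam l -> (j0 <= size u)%N.
Proof.
rewrite /fam; case: unpickle => // f; case: ifP => // /andP[/allP fj _].
exact: fj.
Qed.

Let fam_sum l : \sum_(u <- fam l) w (size u) <= e.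
Proof.
rewrite /fam; case: unpickle => [f|]; last by rewrite big_nil ltW.
by case: ifP => [/andP[]//|_]; rewrite big_nil ltW.
Qed.

(** Passing to the interior makes these sets measurable, and [coded_section_tube] ensures that every
    point of [T0] still lies in one of them. *)
Let V n l : set S := interior [set t | forall c,
  coded_section (mkseq h n) t c -> exists2 u, u \in fam l & exists j, u = mkseq c j].

Let W n : set S := \bigcup_(l in [set l | (l < n)%N]) V n l.

Let open_W n : open (W n).
Proof. by apply: bigcup_open => l _; exact: open_interior. Qed.

Let W_nondecreasing : nondecreasing_seq W.
Proof.
move=> p q pq; apply/subsetPset => t [l /= lp Vl]; exists l => /=.
  exact: leq_trans pq.
move: t Vl; apply: interiorS => t H c [x [s [Hx Hs sh]]]; apply: H.
exists x, s; split=> // i; rewrite size_mkseq => ip; rewrite nth_mkseq //.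
have iq := leq_trans ip pq.
by have := sh i; rewrite size_mkseq nth_mkseq //; exact.
Qed.

Let T0_W : T0 `<=` \bigcup_n W n.
Proof.
move=> t /small_section/(_ _ e0)[Sq [Sqj Sqs Sqc]].
have [N [d d0 HN]] := coded_section_tube h Sqc.
pose f := flatten [seq Sq i | i <- index_iota 0 N].
(* [n] must exceed the index of the family and reach the number [N] of coordinates that have to be
   bounded. *)
pose l := pickle f; exists (maxn N l.+1) => //; exists l => /=.
  by rewrite leq_max ltnSn orbT.
have faml : fam l = f.
  rewrite /fam /l pickleK ifT //; apply/andP; split.
    apply/allP => u /flatten_mapP[i _]; exact: Sqj.
  by rewrite /f big_flatten big_map big_mkord.
apply/nbhs_ballP; exists d => //= t' tt' c [x [s [Hx Hs sh]]].
have [] := HN t' tt' c.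
  exists x, s; split=> // i; rewrite size_mkseq => iN; rewrite nth_mkseq //.
  have im : (i < maxn N l.+1)%N by rewrite leq_max iN.
  by have := sh i; rewrite size_mkseq nth_mkseq //; exact.
move=> i [j [iN cS]]; exists (mkseq c j); last by exists j.
rewrite faml; apply/flatten_mapP; exists i => //.
by rewrite mem_index_iota.
Qed.

Let small_complement (d : R) : 0 < d -> exists n, m (~` W n) <= d.
Proof.
move=> d0; have mW n : mu.-caratheodory (W n) by exact: mu_open.
have mWW : mu.-caratheodory (\bigcup_n W n) by exact: caratheodory_measurable_bigcup.
have muW : mu (\bigcup_n W n) = mu setT.
  rewrite [RHS]mWW !setTI [X in (_ + X)%E](_ : _ = 0%E) ?adde0 //.
  apply/eqP; rewrite eq_le outer_measure_ge0 andbT -muT0.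
  by apply: le_outer_measure; exact: subsetC.
have cvW : mu (W n) @[n --> \oo] --> mu setT.
  rewrite -muW.
  by apply: (@nondecreasing_cvg_mu _ (caratheodory_type mu) R mu W).
apply: contrapT => nod.
have : (mu setT <= (m setT - d)%:E)%E.
  apply: (cvge_le _ cvW); apply: nearW => n.
  have := mW n setT; rewrite !setTI !muE -EFinD => -[->].
  rewrite lee_fin; have /negP : ~ m (~` W n) <= d by move=> ?; apply: nod; exists n.
  by rewrite -ltNge => ?; lra.
by rewrite muE lee_fin; lra.
Qed.

Let D n l : set S := V n l `\` \bigcup_(i in [set i | (i < l)%N]) V n i.

Let mD n l : mu.-caratheodory (D n l).
Proof.
apply: caratheodory_measurable_setD; first exact/mu_open/open_interior.
by apply: mu_open; apply: bigcup_open => i _; exact: open_interior.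
Qed.

Let tD n : trivIset setT (D n).
Proof.
apply/trivIsetP => i j _ _ ij; apply/seteqP; split=> // t [[Vi ni] [Vj nj]].
have [ij'|ji|ij'] := ltngtP i j.
- by apply: nj; exists i.
- by apply: ni; exists j.
- by rewrite ij' eqxx in ij.
Qed.

Let sum_D n : \sum_(l < n) m (D n l) <= m setT.
Proof.
have := caratheodory_additive (@mD n) (@tD n) n setT.
rewrite -lee_fin -sumEFin -muE.
under [in X in _ = X]eq_bigr do rewrite setTI muE.
by move=> <-; exact: le_outer_measure.
Qed.

Let words : seq (seq L) := map val (enum {: j0.-tuple L}).

Let C := \sum_(u <- words) w (size u).

(** Over [D n l], where [l] is the first family that works, the nodes of [fam l] are used, at a
    total cost of at most [e * m setT]. Over the small remainder all words of length [j0] are used,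
    at cost [C] times its measure. *)
Let U n (u : seq L) : set S :=
  \big[setU/set0]_(l < n) (if u \in fam l then D n l else set0) `|`
  (if size u == j0 then ~` W n else set0).

Let U_cover n : node_cover mu j0 (coded_section (mkseq h n)) (U n).
Proof.
split=> [u uj|u|t c Gc].
- rewrite /U (ltn_eqF uj) setU0 big1 // => l _; case: ifP => // /fam_size.
  by rewrite leqNgt uj.
- apply: caratheodory_measurable_setU; last first.
    case: ifP => _; last exact: caratheodory_measurable_set0.
    by apply: caratheodory_measurable_setC; exact: mu_open.
  apply: (caratheodory_measurable_bigsetU
    (A := fun l => if u \in fam l then D n l else set0)) => l.
  by case: ifP => _; [exact: mD|exact: caratheodory_measurable_set0].
have [Wt|nWt] := pselect (W n t); last first.
  by exists j0; right; rewrite size_mkseq eqxx.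
have exl : exists l, (l < n)%N && `[< V n l t >].
  by have [l /= ln Vl] := Wt; exists l; rewrite ln; exact/asboolP.
case: (ex_minnP exl) => l /andP[ln /asboolP Vl] lmin.
have [u uf [j uE]] := interior_subset Vl c Gc.
exists j; left; rewrite -(bigcup_mkord n (fun l => if mkseq c j \in fam l then D n l else set0)).
exists l => //; rewrite -uE uf; split=> // -[i /= il Vi].
have := lmin i; rewrite (ltn_trans il ln) /= leqNgt il.
by move/(_ (introT (asboolP _) Vi)).
Qed.

Let U_weight n :
  (cover_weight mu w (U n) <= (e * m setT + C * m (~` W n))%:E)%E.
Proof.
apply: ge_ereal_sup => _ [E [finE _] <-]; rewrite fsbig_finite //=.
set r := (X in (\sum_(u <- X) _ <= _)%E).
have ur : uniq r by exact: finmap.fset_uniq.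
have sub f : \sum_(u <- r | u \in f) w (size u) <= \sum_(u <- f) w (size u).
  rewrite -big_filter; apply: ler_sum_subset => //; first exact: filter_uniq.
  by move=> u; rewrite mem_filter => /andP[].
under eq_bigr do rewrite muE -EFinM.
rewrite sumEFin lee_fin.
apply: (@le_trans _ _ (\sum_(u <- r)
    (\sum_(l < n) (if u \in fam l then w (size u) * m (D n l) else 0) +
    (if u \in words then w (size u) * m (~` W n) else 0)))).
  apply: ler_sum => u _.
  have : m (U n u) <= \sum_(l < n) (if u \in fam l then m (D n l) else 0) +
      (if u \in words then m (~` W n) else 0).
    rewrite -lee_fin EFinD -muE -sumEFin.
    apply: (le_trans (outer_measureU2 _ _ _)); apply: leeD.
      pose A l := if u \in fam l then D n l else set0.
      apply: (le_trans (outer_measure_subadditive mu A n)).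
      by apply: lee_sum => l _; rewrite /A; case: ifP; rewrite ?outer_measure0 // muE.
    case: ifP => su; last by rewrite outer_measure0 lee_fin; case: ifP.
    rewrite ifT -?muE //; apply/mapP; exists (Tuple su) => //.
    by rewrite mem_enum.
  move/(ler_wpM2l (w0 (size u)))/le_trans; apply.
  rewrite mulrDr mulr_sumr lerD //; last by case: ifP => _; rewrite ?mulr0.
  by apply: ler_sum => l _; case: ifP => _; rewrite ?mulr0.
rewrite big_split /= exchange_big /= lerD //.
  apply: (@le_trans _ _ (\sum_(l < n) e * m (D n l))); last first.
    by rewrite -mulr_sumr ler_pM2l.
  apply: ler_sum => l _; rewrite -big_mkcond /= -mulr_suml ler_wpM2r //.
  exact: le_trans (sub _) (fam_sum l).
by rewrite -big_mkcond /= -mulr_suml ler_wpM2r.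
Qed.

Lemma finite_cover_content (d : R) : 0 < d ->
  exists n, (node_content mu w j0 (coded_section (mkseq h n)) <= (e * m setT + d)%:E)%E.
Proof.
move=> d0; have C0 : 0 <= C by exact: sumr_ge0.
have [n Wn] := small_complement (divr_gt0 d0 (ltr_wpDl C0 ltr01)).
exists n; apply: le_trans; first by apply: node_content_le; exact: U_cover.
apply: (le_trans (U_weight n)); rewrite lee_fin lerD2l.
apply: (le_trans (ler_wpM2l C0 Wn)); rewrite mulrCA ler_piMr ?ltW //.
by rewrite ltr_pdivrMr ?mul1r; lra.
Qed.

End finite_cover.

(* Choquet's capacitability argument: restricting the branches to [s i <= h i]
   one index at a time costs nothing by [node_content_bigcup], and in the limit
   only compact sections are left. *)
Lemma coded_section_content0 :
  node_content mu w j0 (coded_section [::]) = 0%E.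
Proof.
apply/eqP; rewrite eq_le node_content_ge0 // andbT.
apply/lee_addgt0Pr => a a0; rewrite add0e leNgt; apply/negP => aG.
pose P hs := (a%:E < node_content mu w j0 (coded_section hs))%E.
have step hs : exists v, P hs -> P (rcons hs v).
  have [Phs|nP] := pselect (P hs); last by exists 0%N.
  apply: contrapT => nov; move: Phs; apply/negP; rewrite -leNgt.
  apply: (@le_trans _ _ (node_content mu w j0
      (fun t c => exists v, coded_section (rcons hs v) t c))).
    apply: le_node_content => t c [x [s [Hx Hs sh]]]; exists (s (size hs)), x, s.
    split=> // i; rewrite size_rcons ltnS nth_rcons leq_eqVlt => /predU1P[->|ih].
      by rewrite ltnn eqxx.
    by rewrite ih; exact: sh.
  apply: node_content_bigcup => // [v t c [x [s [Hx Hs sh]]]|v].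
    exists x, s; split=> // i; have := sh i; rewrite !size_rcons !nth_rcons.
    move=> /[apply]; case: ifP => // _; case: ifP => // _ /leq_trans; exact.
  rewrite leNgt; apply/negP => Pv; apply: nov; exists v => _; exact: Pv.
have /choice[g Hg] := step.
pose hs := fix hs n := if n is n'.+1 then rcons (hs n') (g (hs n')) else [::].
pose h n := g (hs n).
have hsE n : hs n = mkseq h n by elim: n => // n IH; rewrite mkseqS -IH.
have Ph n : P (hs n) by elim: n => [|n /Hg].
have mT0 : 0 < m setT + 1 by rewrite ltr_wpDl.
have ha : 0 < a / 2 by rewrite divr_gt0.
(* Each of the two terms of the bound gets half of [a]; adding 1 to [m setT] keeps the divisor
   positive. *)
have [n] := finite_cover_content h (divr_gt0 ha mT0) ha.
rewrite -hsE; apply/negP; rewrite -ltNge; apply: le_lt_trans (Ph n).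
rewrite lee_fin [leRHS](splitr a) lerD2r mulrAC ler_pdivrMr //.
by rewrite ler_pM2l // lerDl.
Qed.

End capacity.

(** * Cells and dyadic cubes *)

Section cells.
Context (R : realType) (k : nat).

(** Half-open, so that cells of one side length are disjoint and measures over them add up. The
    cubes in the other factor are closed, as compactness arguments require. *)
Definition cell (h : R) (z : {ffun 'I_k -> int}) : set 'rV[R]_k :=
  [set x | forall i, (z i)%:~R * h <= x ord0 i < (z i + 1)%:~R * h].

Lemma cell_ex (h : R) (x : 'rV[R]_k) : 0 < h ->
  cell h [ffun i => Num.floor (x ord0 i / h)] x.
Proof.
move=> h0 i; rewrite ffunE -ler_pdivlMr // -ltr_pdivrMr //.
by rewrite ge_floor floorD1_gt.
Qed.

Lemma cell_inj (h : R) (x : 'rV[R]_k) z z' : 0 < h ->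
  cell h z x -> cell h z' x -> z = z'.
Proof.
move=> h0; suff H y : cell h y x -> y = [ffun i => Num.floor (x ord0 i / h)].
  by move=> /H -> /H ->.
move=> Hy; apply/ffunP => i; rewrite ffunE; apply/esym/floor_def.
by have := Hy i; rewrite -ler_pdivlMr // -ltr_pdivrMr.
Qed.

End cells.

Section caratheodory_open.
Context (R : realType) (k : nat).
Let lambda := @lebesgue_outer R k.+1.

Lemma cell_caratheodory (h : R) z : lambda.-caratheodory (cell h z).
Proof.
pose H (i : 'I_k.+1) : set 'rV[R]_k.+1 := [set x | x ord0 i < (z i + 1)%:~R * h]
  `&` ~` [set x | x ord0 i < (z i)%:~R * h].
have -> : cell h z = ~` \bigcup_n (if insub n is Some i then ~` H i else set0).
  apply/seteqP; split=> [x xz [n _]|x xn i].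
    case: insubP => [i _ _|//]; apply; split=> /=; last apply/negP; rewrite -?leNgt.
      by case/andP: (xz i).
    by case/andP: (xz i).
  suff [xi /negP] : H i x by rewrite -leNgt => zx; rewrite zx.
  by apply: contrapT => nH; apply: xn; exists i => //; rewrite valK.
apply: caratheodory_measurable_setC; apply: caratheodory_measurable_bigcup => n.
case: insubP => [i _ _|_]; last exact: caratheodory_measurable_set0.
apply: caratheodory_measurable_setC; apply: caratheodory_measurable_setI.
  exact: halfspace_caratheodory.
by apply: caratheodory_measurable_setC; exact: halfspace_caratheodory.
Qed.

(** An open set is the union of the cells of side [1 / (i + 1)] that it contains, over all [i], and
    these are countably many. *)
Lemma open_caratheodory (U : set 'rV[R]_k.+1) : open U -> lambda.-caratheodory U.
Proof.
move=> oU; pose c (n : nat) : set 'rV[R]_k.+1 :=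
  if @unpickle (nat * {ffun 'I_k.+1 -> int})%type n is Some p then
    if `[< cell p.1.+1%:R^-1 p.2 `<=` U >] then cell p.1.+1%:R^-1 p.2 else set0
  else set0.
suff -> : U = \bigcup_n c n.
  apply: caratheodory_measurable_bigcup => n; rewrite /c.
  case: unpickle => [p|]; last exact: caratheodory_measurable_set0.
  by case: ifP => _; [exact: cell_caratheodory|exact: caratheodory_measurable_set0].
apply/seteqP; split=> [x Ux|x [n _]]; last first.
  rewrite /c; case: unpickle => [p|//]; case: ifP => // /asboolP; exact.
have /nbhs_ballP[e /= e0 He] : nbhs x U by exact: open_nbhs_nbhs.
have [i] := @ltr_add_invr R 0 e e0; rewrite add0r => ie.
have i0 : 0 < i.+1%:R^-1 :> R by rewrite invr_gt0 ltr0n.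
pose z : {ffun 'I_k.+1 -> int} := [ffun l => Num.floor (x ord0 l / i.+1%:R^-1)].
have xz : cell i.+1%:R^-1 z x by exact: cell_ex.
exists (pickle (i, z)) => //; rewrite /c pickleK ifT //=.
have dist (a b d h : R) : d <= a < d + h -> d <= b < d + h -> h < e -> `|a - b| < e.
  by rewrite ltr_norml => /andP[? ?] /andP[? ?] ?; apply/andP; split; lra.
apply/asboolP => y yz; apply: He; split=> // a l /=; rewrite (ord1 a : a = ord0).
apply: (dist _ _ ((z l)%:~R * i.+1%:R^-1) i.+1%:R^-1) => //.
  by have := xz l; rewrite intrD mulrDl mul1r.
by have := yz l; rewrite intrD mulrDl mul1r.
Qed.

(* The box of half-width [diam U] around the projection of a point of [U] contains
   the projection of [U]. *)
Lemma lebesgue_null_proj n (S : set 'rV[R]_(k.+1 + n)) :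
  hausdorff_measure k.+1%:R S = 0%E -> lebesgue_outer [set lsubmx x | x in S] = 0%E.
Proof.
move=> /hausdorff_null/(_ 1 ltr01) HS; apply/eqP; rewrite eq_le outer_measure_ge0 andbT.
apply/lee_addgt0Pr => e e0; rewrite add0e.
(* A box of half-width [d] has volume [2 ^+ k.+1 * d ^+ k.+1]. *)
have e20 : 0 < e / 2 ^+ k.+1 by rewrite divr_gt0 // exprn_gt0.
have : (hausdorff_premeasure k.+1%:R 1 S < (e / 2 ^+ k.+1)%:E)%E by rewrite HS lte_fin.
move=> /ereal_inf_lt[_ [U [Ud SU] <-] Ue].
have /choice[p Hp] : forall i, exists p : 'rV[R]_k.+1 * 'rV[R]_k.+1,
   [/\ forall j, p.1 ord0 j <= p.2 ord0 j,
      forall x, U i x -> forall j, p.1 ord0 j <= lsubmx x ord0 j <= p.2 ord0 j &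
      ((\prod_(j < k.+1) (p.2 ord0 j - p.1 ord0 j))%:E <=
        (2 ^+ k.+1)%:E * hausdorff_gauge k.+1%:R (U i))%E].
  move=> i; have [->|/set0P[a Ua]] := eqVneq (U i) set0.
    exists (0, 0); split=> //=.
    by rewrite gauge_set0 mule0 big_ord_recl /= mxE subrr mul0r.
  have dU : diam (U i) = (fine (diam (U i)))%:E.
    by rewrite fineK // ge0_fin_numE ?diam_ge0 // (le_lt_trans (Ud i)) ?ltry.
  set d := fine _ in dU.
  have d0 : 0 <= d by rewrite fine_ge0 // diam_ge0.
  exists (\row_j (lsubmx a ord0 j - d), \row_j (lsubmx a ord0 j + d)); split=> /=.
  - by move=> j; rewrite !mxE; lra.
  - move=> x Ux j; rewrite !mxE -ler_distl.
    by apply: (le_trans (coord_le_edist _ _ _)); rewrite -lee_fin -dU edist_le_diam.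
  under eq_bigr do rewrite !mxE.
  rewrite (eq_bigr (fun=> 2 * d)); last by move=> j _; lra.
  rewrite prodr_const card_ord exprMn.
  rewrite /hausdorff_gauge ifF; last by apply/asboolPn => U0; rewrite U0 in Ua.
  by rewrite dU poweR_EFin powR_mulrn // EFinM.
apply: (@le_trans _ _ (\sum_(0 <= i <oo)
    (\prod_(j < k.+1) ((p i).2 ord0 j - (p i).1 ord0 j))%:E)%E).
  apply: ereal_inf_lbound; exists (fun i => (p i).1), (fun i => (p i).2); split=> //.
    by move=> i; case: (Hp i).
  by move=> _ [x /SU[i _ Ux] <-]; exists i => //=; case: (Hp i) => _ + _; exact.
apply: (@le_trans _ _ (\sum_(0 <= i <oo) (2 ^+ k.+1)%:E *
    hausdorff_gauge k.+1%:R (U i))%E).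
  apply: lee_nneseries => i _; last by case: (Hp i).
  by move=> _; rewrite lee_fin prodr_ge0 // => j _; rewrite subr_ge0; case: (Hp i).
rewrite nneseriesZl; last by move=> i _; exact: gauge_ge0.
rewrite -lee_pdivlMl ?exprn_gt0 // muleC -EFinM; exact: ltW.
Qed.

End caratheodory_open.

Section binary_cubes.
Context (R : realType) (n : nat).
Let L := {ffun 'I_n -> bool}.
Implicit Types (u v : seq L) (x : 'rV[R]_n) (i : 'I_n).

(* [u] lists binary digits, the most significant ones first, one per coordinate. *)
Definition word_index u i : nat := foldl (fun a (l : L) => (a.*2 + l i)%N) 0%N u.

Lemma word_index_rcons u (l : L) i :
  word_index (rcons u l) i = ((word_index u i).*2 + l i)%N.
Proof. by rewrite /word_index foldl_rcons. Qed.

Lemma word_index_inj u v : size u = size v -> word_index u =1 word_index v -> u = v.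
Proof.
elim/last_ind: u v => [|u l IH] v; first by move=> /esym/size0nil.
elim/last_ind: v => [|v l' _]; first by rewrite size_rcons.
rewrite !size_rcons => -[suv] H.
have ll' : l = l'.
  apply/ffunP => i; have := H i; rewrite !word_index_rcons => /(congr1 odd).
  by rewrite !oddD !odd_double /= !oddb.
rewrite ll'; congr rcons; apply: IH => // i.
by have := H i; rewrite !word_index_rcons ll' => /addIn/double_inj.
Qed.

Definition words_near (kappa : 'I_n -> nat) (M j : nat) : seq (seq L) :=
  [seq u <- map val (enum {: j.-tuple L}) |
    [forall i, (word_index u i <= kappa i + M)%N && (kappa i <= word_index u i + M)%N]].

Lemma mem_words_near kappa M j u : (u \in words_near kappa M j) =
  (size u == j) &&
  [forall i, (word_index u i <= kappa i + M)%N && (kappa i <= word_index u i + M)%N].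
Proof.
rewrite mem_filter andbC; congr (_ && _); apply/mapP/eqP => [[t _ ->]|su].
  by rewrite size_tuple.
by exists (Tuple (introT eqP su)); rewrite ?mem_enum.
Qed.

Lemma words_near_uniq kappa M j : uniq (words_near kappa M j).
Proof. by rewrite filter_uniq // (map_inj_uniq val_inj) enum_uniq. Qed.

(** At a fixed length a word is determined by its index, hence by its offset from [kappa], which
    takes at most [2 M + 1] values in each coordinate. *)
Lemma size_words_near kappa M j : (size (words_near kappa M j) <= M.*2.+1 ^ n)%N.
Proof.
pose g u : {ffun 'I_n -> 'I_(M.*2.+1)} := [ffun i => inord (word_index u i + M - kappa i)].
rewrite -(size_map g).
have ug : uniq (map g (words_near kappa M j)).
  rewrite map_inj_in_uniq ?words_near_uniq // => u v.
  rewrite !mem_words_near => /andP[/eqP su /forallP Hu] /andP[/eqP sv /forallP Hv] /ffunP guv.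
  apply: word_index_inj; first by rewrite su sv.
  move=> i; have := congr1 val (guv i); rewrite !ffunE /= => {guv}.
  have := Hu i; have := Hv i; rewrite -!addnn.
  by move=> /andP[? ?] /andP[? ?]; rewrite !inordK; lia.
rewrite -(card_uniqP ug) (leq_trans (max_card _)) //.
by rewrite card_ffun !card_ord.
Qed.

Variable r : R.
Hypothesis r0 : 0 < r.

Definition side (j : nat) : R := 2 * r / 2 ^+ j.

Lemma side_gt0 j : 0 < side j.
Proof. by rewrite divr_gt0 ?mulr_gt0 ?exprn_gt0. Qed.

Lemma sideS j : side j = 2 * side j.+1.
Proof. by rewrite /side exprS invfM; field. Qed.

(** Adding [r] shifts the root cube [[-r, r]^n] to [[0, 2 r]^n], where indices count from 0. *)
Definition cube u : set 'rV[R]_n := [set x | forall i,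
  (word_index u i)%:R * side (size u) <= x ord0 i + r <=
  (word_index u i).+1%:R * side (size u)].

Lemma cube0P x : cube [::] x <-> forall i, `|x ord0 i| <= r.
Proof.
split=> H i; have := H i; rewrite /= /word_index /= /side expr0 divr1 mul0r mul1r.
  by rewrite ler_norml => /andP[? ?]; apply/andP; split; lra.
by rewrite ler_norml => /andP[? ?]; apply/andP; split; lra.
Qed.

Lemma cube_compact : compact (cube [::]).
Proof.
have -> : cube [::] = [set x : 'rV[R]_n | forall i, `[- r, r]%classic (x ord0 i)].
  apply/seteqP; split=> x => [/cube0P|] H; [|apply/cube0P] => i; have := H i.
    by rewrite /= in_itv /= -ler_norml.
  by rewrite /= in_itv /= -ler_norml.
by apply: (@rV_compact _ _ (fun=> `[- r, r]%classic)) => i; exact: segment_compact.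
Qed.

Lemma cube_closed u : closed (cube u).
Proof.
have -> : cube u = \bigcap_(i in [set: 'I_n]) ((fun x : 'rV[R]_n => x ord0 i) @^-1`
    `[(word_index u i)%:R * side (size u) - r, (word_index u i).+1%:R * side (size u) - r]%classic).
  apply/seteqP; split=> x H i => [_|]; last first.
    by have := H i I; rewrite /= in_itv /= lerBlDr lerBrDr.
  by have := H i; rewrite /= in_itv /= lerBlDr lerBrDr.
apply: closed_bigI => i _; apply: closed_comp => [x _|]; first exact: coord_continuous.
exact: interval_closed.
Qed.

Lemma code_ex x : cube [::] x -> exists c : nat -> L, forall j, cube (mkseq c j) x.
Proof.
move=> x0; have step u : exists l : L, cube u x -> cube (rcons u l) x.
  pose l : L := [ffun i => (word_index u i).*2.+1%:R * side (size u).+1 <= x ord0 i + r].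
  exists l => xu i; rewrite size_rcons word_index_rcons ffunE.
  have := xu i; rewrite sideS => /andP[]; set K := word_index u i.
  set d := side _ => xl xr.
  have [ld|ld] := leP (K.*2.+1%:R * d) (x ord0 i + r); rewrite /= ?addn0 ?addn1.
    by rewrite ld (le_trans xr) // mulrA -natrM muln2 doubleS.
  by rewrite (ltW ld) andbT (le_trans _ xl) // mulrA -natrM muln2.
have [g Hg] := choice step.
pose us := fix us j := if j is j'.+1 then rcons (us j') (g (us j')) else [::].
exists (fun j => g (us j)) => j.
have -> : mkseq (fun j => g (us j)) j = us j by elim: j => // j IH; rewrite mkseqS IH.
by elim: j => // j IH; exact: Hg.
Qed.

(** The additional 1 accounts for the positions of the points inside their cubes. *)
Lemma word_index_near u v x y (M : nat) i : size u = size v -> cube u x -> cube v y ->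
  `|x ord0 i - y ord0 i| <= M%:R * side (size u) ->
  (word_index v i <= word_index u i + M.+1)%N.
Proof.
move=> suv /(_ i) /andP[_ xu] /(_ i) /andP[yv _]; rewrite ler_norml => /andP[xy _].
rewrite -(ler_nat R) -(ler_pM2r (side_gt0 (size u))).
apply: (@le_trans _ _ (y ord0 i + r)); first by rewrite suv.
have : (word_index u i + M.+1)%:R = (word_index u i).+1%:R + M%:R :> R.
  by rewrite -natrD addSnnS.
by move=> ->; rewrite mulrDl; lra.
Qed.

Lemma words_near_cube u v x y (M : nat) : size u = size v -> cube u x -> cube v y ->
  (forall i, `|x ord0 i - y ord0 i| <= M%:R * side (size u)) ->
  v \in words_near (word_index u) M.+1 (size u).
Proof.
move=> suv xu yv xy; rewrite mem_words_near suv eqxx; apply/forallP => i /=.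
rewrite (word_index_near suv xu yv (xy i)) /=.
apply: (word_index_near (esym suv) yv xu).
by rewrite distrC -suv.
Qed.

End binary_cubes.

(** * Null sections *)

Section null_word_cover.
Context (R : realType) (n : nat) (r : R).
Hypothesis r0 : 0 < r.
Let L := {ffun 'I_n -> bool}.

(** Its [j]-th power is [2^(-js)], the [s]-gauge of a cube of level [j] up to a constant. *)
Definition half_pow (s : R) : R := 2^-1 `^ s.

Lemma half_pow_gt0 s : 0 < half_pow s.
Proof. by rewrite powR_gt0 // invr_gt0. Qed.

Lemma half_pow_lt1 s : 0 < s -> half_pow s < 1.
Proof.
move=> s0; have <- : 1 `^ s = 1 :> R by rewrite powR1.
by apply: gt0_ltr_powR; rewrite ?nnegrE ?invr_ge0 // invf_lt1 // ltr1n.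
Qed.

Lemma half_powX s j : half_pow s ^+ j = (2^-1 ^+ j) `^ s.
Proof. by rewrite -powR_mulrn ?powR_ge0 // powRAC powR_mulrn // invr_ge0. Qed.

Lemma expr_small (q e : R) (N : nat) : 0 <= q -> q < 1 -> 0 < e ->
  exists2 j, (N <= j)%N & q ^+ j <= e.
Proof.
move=> q0 q1 e0; have nq : `|q| < 1 by rewrite ger0_norm.
have /cvgrPdist_le/(_ _ e0)[M _ HM] := cvg_expr nq.
exists (maxn N M); first exact: leq_maxl.
have := HM (maxn N M) (leq_maxr _ _).
by rewrite sub0r normrN ger0_norm // exprn_ge0.
Qed.

(** At the last level whose side is at least [d], [2^-j] is below [d / r]. If [d] is 0 or tiny, a
    level of weight at most [tau] serves instead. *)
Lemma side_scale (s d tau : R) (j0 : nat) : 0 < s -> 0 <= d -> 0 < tau ->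
  d <= side r j0 ->
  exists j, [/\ (j0 <= j)%N, d <= side r j & half_pow s ^+ j <= (d / r) `^ s + tau].
Proof.
move=> s0 d0 tau0 dj0.
have [J j0J HJ] := expr_small j0 (ltW (half_pow_gt0 s)) (half_pow_lt1 s0) tau0.
have [dJ|Jd] := leP d (side r J).
  by exists J; split=> //; rewrite (le_trans HJ) // lerDr powR_ge0.
have exj : exists j, side r j < d by exists J.
case: (ex_minnP exj) => -[|j] jd jmin.
  have : side r j0 <= side r 0.
    by rewrite /side ler_pM2l ?mulr_gt0 // lef_pV2 ?posrE ?exprn_gt0 // exprn_ege1 // ler1n.
  lra.
exists j; split.
- rewrite leqNgt; apply/negP => jj0.
  have : side r j0 <= side r j.+1.
    rewrite /side ler_pM2l ?mulr_gt0 // lef_pV2 ?posrE ?exprn_gt0 //.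
    by rewrite ler_eXn2l // ltr1n.
  lra.
- by rewrite leNgt; apply/negP => /jmin; rewrite ltnn.
rewrite half_powX (le_trans _ (_ : (d / r) `^ s <= _)) ?lerDl ?(ltW tau0) //.
have e0 : 0 <= 2^-1 ^+ j :> R by rewrite exprn_ge0 // invr_ge0.
apply: ge0_ler_powR; rewrite ?nnegrE ?(ltW s0) ?divr_ge0 ?(ltW r0) //.
rewrite ler_pdivlMr // (le_trans _ (ltW jd)) // /side exprS invfM exprVn.
by rewrite mulrACA divff // mul1r mulrC.
Qed.

Lemma piece_word_cover (s tau : R) (j0 : nat) (U : set 'rV[R]_n) :
  0 < s -> 0 < tau -> (diam U <= (side r j0)%:E)%E ->
  exists S : seq (seq L), [/\ forall u, u \in S -> (j0 <= size u)%N,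
    ((\sum_(u <- S) half_pow s ^+ size u)%:E <=
      ((5 ^ n)%:R * (1 + r^-1 `^ s))%:E * (hausdorff_gauge s U + tau%:E))%E &
    forall c x, U x -> (forall j, cube r (mkseq c j) x) -> exists j, mkseq c j \in S].
Proof.
move=> s0 tau0 Ud; have C0 : 0 <= 1 + r^-1 `^ s by rewrite addr_ge0 ?powR_ge0.
have [[a [Ua a0]]|noU] := pselect (exists a, U a /\ cube r [::] a); last first.
  exists [::]; split=> //.
    rewrite big_nil; apply: mule_ge0; rewrite ?lee_fin ?mulr_ge0 //.
    by rewrite adde_ge0 ?gauge_ge0 // lee_fin ltW.
  by move=> c x Ux /(_ 0%N) x0; exfalso; apply: noU; exists x.
have dU : diam U = (fine (diam U))%:E.
  by rewrite fineK // ge0_fin_numE ?diam_ge0 // (le_lt_trans Ud) ?ltry.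
set d := fine _ in dU.
have d0 : 0 <= d by rewrite fine_ge0 // diam_ge0.
have gU : hausdorff_gauge s U = (d `^ s)%:E.
  rewrite /hausdorff_gauge ifF ?dU ?poweR_EFin //.
  by apply/asboolPn => U0; rewrite U0 in Ua.
rewrite dU lee_fin in Ud; have [j [j0j dj Hj]] := side_scale s0 d0 tau0 Ud.
have [ca Hca] := code_ex a0.
(* Points of [U] are at most one side apart, so the indices of their cubes differ by at most 2 from
   those of a cube of [a], whence the factor [5 ^ n]. *)
exists (words_near (word_index (mkseq ca j)) 2 j); split.
- by move=> u; rewrite mem_words_near => /andP[/eqP ->].
- rewrite gU -EFinD -EFinM lee_fin.
  rewrite (eq_big_seq (fun=> half_pow s ^+ j)); last first.
    by move=> u; rewrite mem_words_near => /andP[/eqP ->].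
  rewrite big_const_seq count_predT iter_addr_0 -[leLHS]mulr_natl -[leRHS]mulrA.
  apply: ler_pM; rewrite ?exprn_ge0 ?(ltW (half_pow_gt0 _)) //.
    by rewrite ler_nat; exact: size_words_near.
  apply: (le_trans Hj); rewrite powRM ?invr_ge0 ?(ltW r0) //.
  have := powR_ge0 d s; have := powR_ge0 r^-1 s; nra.
move=> c x Ux cx; exists j.
have := @words_near_cube R n r r0 (mkseq ca j) (mkseq c j) a x 1.
rewrite !size_mkseq; apply => // i; rewrite mul1r.
apply: (le_trans (coord_le_edist _ _ _)); apply: le_trans dj.
by rewrite -lee_fin -dU edist_le_diam.
Qed.

Lemma null_word_cover (s e : R) (j0 : nat) (A : set 'rV[R]_n) : 0 < s -> 0 < e ->
  hausdorff_measure s A = 0%E ->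
  exists Sq : nat -> seq (seq L), [/\ forall i u, u \in Sq i -> (j0 <= size u)%N,
    forall N, \sum_(i < N) \sum_(u <- Sq i) half_pow s ^+ size u <= e &
    forall c x, A x -> (forall j, cube r (mkseq c j) x) ->
      exists i j, mkseq c j \in Sq i].
Proof.
move=> s0 e0 /hausdorff_null/(_ _ (side_gt0 r0 j0)) HA.
set C := (5 ^ n)%:R * (1 + r^-1 `^ s).
have C0 : 0 < C by rewrite mulr_gt0 ?ltr0n ?expn_gt0 // ltr_wpDr ?powR_ge0.
(* The gauges add up to less than [tau] and the errors [tau / 2 ^+ i.+1] to at most [tau]; [C] times
   their sum is [e]. *)
pose tau := e / (2 * C); have tau0 : 0 < tau by rewrite divr_gt0 // mulr_gt0.
have : (hausdorff_premeasure s (side r j0) A < tau%:E)%E by rewrite HA lte_fin.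
move=> /ereal_inf_lt[_ [U [Ud AU] <-] Utau].
have /choice[Sq HS] := fun i => piece_word_cover s0
  (divr_gt0 tau0 (exprn_gt0 i.+1 (ltr0Sn R 1))) (Ud i).
exists Sq; split.
- by move=> i u; case: (HS i) => + _ _; exact.
- move=> N; rewrite -lee_fin -sumEFin.
  apply: (@le_trans _ _ (\sum_(i < N) C%:E *
      (hausdorff_gauge s (U i) + (tau / 2 ^+ i.+1)%:E))%E).
    by apply: lee_sum => i _; case: (HS i).
  have nn i : (0 <= hausdorff_gauge s (U i) + (tau / 2 ^+ i.+1)%:E)%E.
    by rewrite adde_ge0 ?gauge_ge0 // lee_fin divr_ge0 ?(ltW tau0) // exprn_ge0.
  rewrite -ge0_sume_distrr // big_split /= sumEFin.
  apply: (@le_trans _ _ (C%:E * (tau%:E + tau%:E))%E); last first.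
    by rewrite -EFinD -EFinM lee_fin /tau le_eqVlt; apply/predU1P; left; field; lra.
  apply: lee_wpmul2l; first by rewrite lee_fin ltW.
  apply: leeD.
    apply: le_trans (ltW Utau); rewrite -(big_mkord xpredT (fun i => hausdorff_gauge s (U i))).
    by apply: nneseries_lim_ge => i _ _; exact: gauge_ge0.
  rewrite lee_fin -mulr_sumr ler_piMr ?(ltW tau0) //.
  have -> : \sum_(i < N) (2 ^+ i.+1)^-1 = 1 - (2 ^+ N)^-1 :> R.
    elim: N => [|N IH]; first by rewrite big_ord0 expr0 invr1 subrr.
    rewrite big_ord_recr /= IH exprS invfM; set z := (2 ^+ N)^-1; lra.
  by rewrite gerBl invr_ge0 exprn_ge0.
by move=> c x /AU[i _ Ux] cx; exists i; case: (HS i) => _ _ /(_ c x Ux cx).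
Qed.

End null_word_cover.

(** * Selection of the dense products *)

Lemma row_mx_continuous (R : realType) (p q : nat) :
  continuous (fun x : 'rV[R]_p * 'rV[R]_q => row_mx x.1 x.2).
Proof.
move=> [t x] U /nbhs_ballP[e /= e0 He]; exists (ball t e, ball x e) => /=.
  by split; exact: nbhsx_ballx.
move=> [t' x'] /= [[_ Ht] [_ Hx]]; apply: He; split=> // i j; rewrite !mxE.
by case: (fintype.split j) => l; [exact: Ht|exact: Hx].
Qed.

Section outer_measure_sums.
Context (R : realType) (T : Type) (mu : {outer_measure set T -> \bar R}) (K : eqType).

Lemma sum_caratheodory_le (D : K -> set T) (X : set T) (l : seq K) :
  (forall z, mu.-caratheodory (D z)) -> (forall x z z', D z x -> D z' x -> z = z') ->
  uniq l -> (\sum_(z <- l) mu (X `&` D z) <= mu X)%E.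
Proof.
move=> mD dD; elim: l X => [|z l IH] X; first by rewrite big_nil outer_measure_ge0.
move=> /= /andP[zl ul]; rewrite big_cons [leRHS](mD z); apply: leeD2l.
apply: le_trans (IH (X `&` ~` D z) ul); rewrite big_seq [leRHS]big_seq.
apply: lee_sum => z' z'l; apply: le_outer_measure => x [Xx Dx]; split=> //.
by split=> // Dz; rewrite (dD _ _ _ Dz Dx) z'l in zl.
Qed.

Lemma outer_measure_bigcup_seq (A : K -> set T) (l : seq K) :
  (mu (\bigcup_(z in [set` l]) A z) <= \sum_(z <- l) mu (A z))%E.
Proof.
elim: l => [|z l IH].
  rewrite big_nil (_ : \bigcup_(z in _) A z = set0) ?outer_measure0 //.
  by apply/seteqP; split=> // x [].
rewrite big_cons; apply: (le_trans _ (leeD2l _ IH)); apply: le_trans (outer_measureU2 _ _ _).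
apply: le_outer_measure => x [z' /=]; rewrite inE => /predU1P[->|z'l] Ax; [left|right] => //.
by exists z'.
Qed.

End outer_measure_sums.

Lemma esum_le_seq (R : realType) (K : choiceType) (a : K -> \bar R) (M : \bar R) :
  (forall l : seq K, uniq l -> (\sum_(z <- l) a z <= M)%E) ->
  (\esum_(z in [set: K]) a z <= M)%E.
Proof.
move=> H; apply: ge_ereal_sup => _ [F [finF _] <-]; rewrite fsbig_finite //.
by apply: H; exact: finmap.fset_uniq.
Qed.

Lemma esum_ge_seq (R : realType) (K : choiceType) (a : K -> \bar R) (l : seq K) :
  uniq l -> (\sum_(z <- l) a z <= \esum_(z in [set: K]) a z)%E.
Proof.
move=> ul; apply: esum_ge; exists [set` l]; first by split=> //; exact: finite_seq.
by rewrite fsbig_seq.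
Qed.

Lemma nneseries_geometric (R : realType) (a q : R) : 0 <= q < 1 ->
  (\sum_(0 <= i <oo) (a * q ^+ i)%:E = (a / (1 - q))%:E)%E.
Proof.
move=> /andP[q0 q1]; apply/cvg_lim => //.
have nq : `|q| < 1 by rewrite ger0_norm.
under eq_fun do rewrite sumEFin.
by apply: cvg_EFin; [exact: nearW|exact: cvg_geometric_series nq].
Qed.

Section stage.
Context (R : realType) (k n : nat).
Let K := k.+1.
Let lambda : {outer_measure set 'rV[R]_K -> \bar R} := @lebesgue_outer R K.
Variables (r s s' : R) (B : set 'rV[R]_(K + n)) (T : set 'rV[R]_K).
Hypotheses (r0 : 0 < r) (s0 : 0 < s) (ss' : s < s').
Hypothesis borelB : borel B.
Hypothesis nullB : forall t, T t -> hausdorff_measure s (slice B t) = 0%E.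

Let L := {ffun 'I_n -> bool}.
Let T1 : set 'rV[R]_K := [set t | T t /\ forall j, `|t ord0 j| <= r].
Let mu : {outer_measure set 'rV[R]_K -> \bar R} := outer_restr lambda T1.
(** [omega ^+ j], that is [2^(-js)], is the weight of a cube of level [j]; [rho ^+ j], that is
    [2^(-j(s'-s))], sets the density under which a product is discarded. *)
Let omega := half_pow s.
Let rho := half_pow (s' - s).

Let rho01 : 0 <= rho < 1.
Proof. by rewrite ltW ?half_pow_gt0 //= half_pow_lt1 // subr_gt0. Qed.

Let omega0 : 0 < omega. Proof. exact: half_pow_gt0. Qed.

Let rho0 : 0 < rho. Proof. exact: half_pow_gt0. Qed.

Lemma stage_cover (i : nat) (e : R) : 0 < e -> exists U : seq L -> set 'rV[R]_K,
  node_cover mu i (fun t c => exists x,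
    (forall j, cube r (mkseq c j) x) /\ B (row_mx t x)) U /\
  (cover_weight mu (fun j => (omega ^+ j)%R) U <= e%:E)%E.
Proof.
move=> e0; have [F [cF BF]] := borel_souslin borelB.
pose F' u := [set p : 'rV[R]_K * 'rV[R]_n | F u (row_mx p.1 p.2)].
have cF' u : closed (F' u).
  by apply: closed_comp (cF u) => p _; exact: row_mx_continuous.
pose G := @coded_section R 'rV[R]_K 'rV[R]_n L (@cube R n r) F'.
have GE t c : G [::] t c <-> exists x,
    (forall j, cube r (mkseq c j) x) /\ B (row_mx t x).
  split=> [[x [a [Hx Ha _]]]|[x [Hx /BF[a Ha]]]]; exists x.
    by split=> //; apply/BF; exists a.
  by exists a; split.
have wge j : 0 <= omega ^+ j by rewrite exprn_ge0 // ltW.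
have : node_content mu (fun j => omega ^+ j) i (G [::]) = 0%E.
  apply: (@coded_section_content0 R 'rV[R]_K 'rV[R]_n L (@cube R n r) F'
    (@cube_closed R n r) (@cube_compact R n r) cF' mu (fun j => omega ^+ j) i T1) => //.
  - change (lambda (setT `&` T1) < +oo)%E; rewrite setTI.
    apply: le_lt_trans (lebesgue_outer_bounded k (ltW r0)).
    by apply: le_outer_measure => t [].
  - by move=> U oU; apply: outer_restr_caratheodory; exact: open_caratheodory.
  (* The complement of [T1] is null for the restriction even if [T1] is not measurable. *)
  - by change (lambda (~` T1 `&` T1) = 0%E); rewrite setICl outer_measure0.
  move=> t [Tt _] d d0.
  have [Sq [H1 H2 H3]] := null_word_cover r0 i s0 d0 (nullB Tt).
  by exists Sq; split=> // c /GE[x [cx Bx]]; exact: H3 cx.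
move=> cG; have : (node_content mu (fun j => (omega ^+ j)%R) i (G [::]) < e%:E)%E.
  by rewrite cG lte_fin.
move=> /ereal_inf_lt[_ [U [U0 mU cU] <-] /ltW Ue]; exists U; split=> //.
by split=> // t c /GE; exact: cU.
Qed.

Let h (j : nat) : R := r / 2 ^+ j.

Let h_gt0 j : 0 < h j. Proof. by rewrite divr_gt0 // exprn_gt0. Qed.

Section kept.
Variables (i : nat) (U : seq L -> set 'rV[R]_K).

(* Cells where [U u] is too sparse are discarded: a Lipschitz graph meets few
   cubes over each cell, so this loses little of it, while the number of
   the remaining cells is controlled by the measure of [U u]. *)
Let kept (u : seq L) (z : {ffun 'I_K -> int}) : Prop :=
  (i <= size u)%N /\
  ((rho ^+ size u * (2^-1 ^+ size u) ^+ K)%:E <= mu (U u `&` cell (h (size u)) z))%E.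

Let piece (u : seq L) (z : {ffun 'I_K -> int}) : set 'rV[R]_(K + n) :=
  if `[< kept u z >] then
    [set y | cell (h (size u)) z (lsubmx y) /\ cube r u (rsubmx y)] else set0.

Definition kept_set : set 'rV[R]_(K + n) := \bigcup_u \bigcup_z piece u z.

(** A length, not an exponent: cubes of level [j] have side [2 r / 2 ^+ j], cells half of that, and
    the square root passes from coordinates to the Euclidean distance. *)
Let q := Num.sqrt (K + n)%:R * (2 * r).

Let q_ge0 : 0 <= q. Proof. by rewrite mulr_ge0 ?sqrtr_ge0 // mulr_ge0 // ltW. Qed.

Let diam_piece u z : (diam (piece u z) <= (q * 2^-1 ^+ size u)%:E)%E.
Proof.
have qu : 0 <= q * 2^-1 ^+ size u by rewrite mulr_ge0 // exprn_ge0 // invr_ge0.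
rewrite /piece; case: ifP => _; last by rewrite diam_set0 lee_fin.
apply: diam_le => // x y [xz xu] [yz yu].
rewrite exprVn -mulrA; apply: edist_le_coord.
  by rewrite divr_ge0 ?exprn_ge0 // mulr_ge0 // ltW.
move=> l; rewrite -(splitK l); case: (fintype.split l) => j /=.
  have := xz j; have := yz j; rewrite !mxE intrD mulrDl mul1r /h.
  have := h_gt0 (size u); rewrite /h -mulrA; set a := r / _; set b := _ * a.
  move=> a0 /andP[? ?] /andP[? ?]; rewrite ler_norml; apply/andP; split; lra.
have := xu j; have := yu j; rewrite !mxE -natr1 mulrDl mul1r /side.
set a := 2 * r / _; set b := _ * a.
by move=> /andP[? ?] /andP[? ?]; rewrite ler_norml; apply/andP; split; lra.
Qed.

(** The second factor is the threshold in [kept], which was chosen for this: the gauge of a kept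
    piece is at most a constant times [omega ^+ size u] times the measure of [U u] in its cell. *)
Let kept_pow (u : seq L) : (2^-1 ^+ size u) `^ (K%:R + s') =
  omega ^+ size u * (rho ^+ size u * (2^-1 ^+ size u) ^+ K).
Proof.
have p0 : 2^-1 ^+ size u != 0 :> R by rewrite expf_neq0 // invr_eq0.
have -> : K%:R + s' = K%:R + (s + (s' - s)) by rewrite addrC subrKC addrC.
rewrite /rho /omega; move: (s' - s) => a.
rewrite !powRD ?p0 ?implybT // powR_mulrn ?exprn_ge0 ?invr_ge0 // -!half_powX.
ring.
Qed.

Let gauge_piece u z : (hausdorff_gauge (K%:R + s') (piece u z) <=
  (q `^ (K%:R + s') * omega ^+ size u)%:E * mu (U u `&` cell (h (size u)) z))%E.
Proof.
have [kz|nk] := pselect (kept u z); last first.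
  rewrite /piece ifF; last exact/asboolPn.
  by rewrite gauge_set0 mule_ge0 ?outer_measure_ge0 // lee_fin mulr_ge0 ?powR_ge0 ?exprn_ge0 ?ltW.
have Ks : 0 <= K%:R + s' by rewrite addr_ge0 // ltW // (lt_trans s0).
apply: (le_trans (gauge_le Ks (diam_piece u z))).
rewrite powRM ?exprn_ge0 ?invr_ge0 // kept_pow mulrA EFinM.
apply: lee_wpmul2l; last exact: kz.2.
by rewrite lee_fin mulr_ge0 ?powR_ge0 ?exprn_ge0 ?ltW.
Qed.

(** By [gauge_piece], summing over the disjoint cells leaves at most [mu (U u)], and summing over
    the words leaves the weight of the cover. *)
Lemma kept_premeasure (e delta : R) : 0 < delta -> q * 2^-1 ^+ i <= delta ->
  (cover_weight mu (fun j => (omega ^+ j)%R) U <= e%:E)%E ->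
  (hausdorff_premeasure (K%:R + s') delta kept_set <= (q `^ (K%:R + s') * e)%:E)%E.
Proof.
move=> d0 qd wU.
have C0 : (0 <= (q `^ (K%:R + s'))%:E)%E by rewrite lee_fin powR_ge0.
have pd (p : seq L * {ffun 'I_K -> int}) : (diam (piece p.1 p.2) <= delta%:E)%E.
  have [kz|nk] := pselect (kept p.1 p.2); last first.
    by rewrite /piece ifF ?diam_set0 ?lee_fin ?ltW //; exact/asboolPn.
  apply: (le_trans (diam_piece _ _)); rewrite lee_fin (le_trans _ qd) //.
  apply: ler_wpM2l => //; apply: ler_wiXn2l; rewrite ?invr_ge0 ?invf_le1 ?ler1n //.
  exact: kz.1.
apply: (@le_trans _ _ (\esum_(p in [set: seq L * {ffun 'I_K -> int}])
    hausdorff_gauge (K%:R + s') (piece p.1 p.2))%E).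
  apply: premeasure_le_esum => // y [u _ [z _ yz]]; by exists (u, z).
rewrite (_ : [set: _] = [set: seq L] `*`` (fun=> [set: {ffun 'I_K -> int}])); last first.
  by apply/seteqP; split.
rewrite -(esum_esum (a := fun u z => hausdorff_gauge (K%:R + s') (piece u z))); last first.
  by move=> u z _ _; exact: gauge_ge0.
apply: (@le_trans _ _ (\esum_(u in [set: seq L])
    ((q `^ (K%:R + s'))%:E * ((omega ^+ size u)%:E * mu (U u))))%E).
  apply: le_esum => u _; apply: esum_le_seq => l ul.
  apply: (@le_trans _ _ (\sum_(z <- l) (q `^ (K%:R + s') * omega ^+ size u)%:E *
      mu (U u `&` cell (h (size u)) z))%E).
    by apply: lee_sum => z _; exact: gauge_piece.
  rewrite -ge0_sume_distrr; last by move=> z _; exact: outer_measure_ge0.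
  rewrite muleA -EFinM; apply: lee_wpmul2l.
    by rewrite lee_fin mulr_ge0 ?powR_ge0 ?exprn_ge0 ?ltW.
  apply: sum_caratheodory_le => //.
    by move=> z; apply: outer_restr_caratheodory; exact: cell_caratheodory.
  by move=> x z z'; exact: cell_inj.
apply: esum_le_seq => l ul; rewrite -ge0_sume_distrr; last first.
  by move=> u _; rewrite mule_ge0 ?outer_measure_ge0 // lee_fin exprn_ge0 ?ltW.
rewrite EFinM; apply: lee_wpmul2l => //; apply: le_trans wU.
exact: (esum_ge_seq (fun u => (omega ^+ size u)%:E * mu (U u))%E).
Qed.

Variables (f : 'rV[R]_K -> 'rV[R]_n) (lip : nat).
Hypothesis f_lip : forall (t t' : 'rV[R]_K) (d : R), 0 <= d ->
  (forall j, `|t ord0 j - t' ord0 j| <= d) ->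
  forall l, `|f t ord0 l - f t' ord0 l| <= lip%:R * d.

Let bad (j : nat) : set 'rV[R]_K := [set t | T1 t /\ exists u z,
  [/\ size u = j, U u t, cell (h j) z t, cube r u (f t) & ~ kept u z]].

Let nu : nat := (lip.+1.*2.+1 ^ n)%N.

(** One bad parameter [t0] in the cell provides a reference word [u0]. By the Lipschitz bound the
    graph over the cell only meets cubes near that of [u0], at most [nu] of them, and each discarded
    product has measure below the threshold. *)
Let bad_cell j z : (i <= j)%N ->
  (lambda (bad j `&` cell (h j) z) <= (nu%:R * (rho ^+ j * (2^-1 ^+ j) ^+ K))%:E)%E.
Proof.
move=> ij; set thr := rho ^+ j * _.
have thr0 : 0 <= thr by rewrite mulr_ge0 ?exprn_ge0 ?invr_ge0 ?ltW // exprn_gt0 // invr_gt0.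
have [[t0 [[T1t0 [u0 [z0 [su0 _ z0t0 u0t0 _]]]] zt0]]|no] :=
    pselect ((bad j `&` cell (h j) z) !=set0); last first.
  rewrite (_ : bad j `&` _ = set0) ?outer_measure0 ?lee_fin ?(mulr_ge0 (ler0n _ _) thr0) //.
  by apply/seteqP; split=> // t Ht; apply: no; exists t.
pose A (u : seq L) := if `[< kept u z >] then set0 else U u `&` cell (h j) z `&` T1.
pose l := words_near (word_index u0) lip.+1 j.
apply: (@le_trans _ _ (lambda (\bigcup_(u in [set` l]) A u))).
  apply: le_outer_measure => t [[T1t [u [z' [su Uut z't ut nk]]]] zt].
  have zz' : z' = z by exact: cell_inj z't zt.
  rewrite zz' in nk z't; exists u; last by rewrite /A ifF //; exact/asboolPn.
  rewrite /= /l -su0; apply: (words_near_cube r0 _ u0t0 ut); first by rewrite su0 su.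
  move=> a; apply: (@le_trans _ _ (lip%:R * h j)).
    apply: f_lip; first exact: ltW.
    move=> b; have := zt b; have := zt0 b; rewrite intrD mulrDl mul1r.
    by move=> /andP[? ?] /andP[? ?]; rewrite ler_norml; apply/andP; split; lra.
  rewrite ler_wpM2l // su0 /side /h -mulrA ler_peMl ?ler1n //.
  exact: ltW (h_gt0 j).
apply: (le_trans (outer_measure_bigcup_seq _ _ _)).
apply: (@le_trans _ _ (\sum_(u <- l) thr%:E)%E).
  rewrite big_seq [leRHS]big_seq; apply: lee_sum => u.
  rewrite mem_words_near => /andP[/eqP su _]; rewrite /A; case: ifP => [_|/asboolPn nk].
    by rewrite outer_measure0 lee_fin.
  rewrite leNgt; apply/negP => lt; apply: nk; split; first by rewrite su.
  by rewrite su; exact: ltW.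
rewrite sumEFin lee_fin big_const_seq count_predT iter_addr_0 -[leLHS]mulr_natl.
by rewrite ler_wpM2r // ler_nat size_words_near.
Qed.

(** In each direction [[-r, r]] meets the cells of indices [-N] to [N], the last one only at its end
    [r]. Their number, at most [(3 * 2 ^ j) ^ K], is compensated by the factor [2^(-jK)] of the
    threshold. *)
Let bad_le j : (i <= j)%N -> (lambda (bad j) <= ((3 ^ K * nu)%:R * rho ^+ j)%:E)%E.
Proof.
move=> ij; pose N := (2 ^ j)%N.
pose zz (g : {ffun 'I_K -> 'I_(N.*2.+1)}) : {ffun 'I_K -> int} :=
  [ffun l => (g l)%:Z - N%:Z].
pose A g := bad j `&` cell (h j) (zz g).
have h0 := h_gt0 j.
have Nh : N%:R * h j = r by rewrite /N natrX /h mulrCA mulfV ?mulr1 // expf_neq0.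
apply: (@le_trans _ _ (lambda (\bigcup_(g in [set` enum {: {ffun 'I_K -> 'I_(N.*2.+1)}}]) A g))).
  apply: le_outer_measure => t bt; have [[_ tr] _] := bt.
  pose z : {ffun 'I_K -> int} := [ffun l => Num.floor (t ord0 l / h j)].
  have zt : cell (h j) z t by exact: cell_ex.
  have zN l : (- N%:Z <= z l <= N%:Z)%R.
    have := tr l; rewrite ler_norml -Nh => /andP[t1 t2]; rewrite ffunE; apply/andP; split.
      by rewrite floor_ge_int_tmp ler_pdivlMr // rmorphN mulNr.
    rewrite -(ler_int R) (le_trans (ge_floor _)) // ler_pdivrMr //.
  exists [ffun l => inord (absz (z l + N%:Z))]; first by rewrite /= mem_enum.
  split=> //; rewrite (_ : zz _ = z) //; apply/ffunP => l; rewrite ffunE ffunE.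
  by have := zN l; move: (z l) => y; rewrite -addnn => /andP[? ?]; rewrite inordK; lia.
apply: (le_trans (outer_measure_bigcup_seq _ _ _)).
apply: (@le_trans _ _ (\sum_(g <- enum {: {ffun 'I_K -> 'I_(N.*2.+1)}})
    (nu%:R * (rho ^+ j * (2^-1 ^+ j) ^+ K))%:E)%E).
  by apply: lee_sum => g _; exact: bad_cell.
rewrite sumEFin lee_fin big_const_seq count_predT iter_addr_0 -cardE card_ffun !card_ord.
rewrite -[leLHS]mulr_natl natrM.
have -> : (N.*2.+1 ^ K)%:R * (nu%:R * (rho ^+ j * (2^-1 ^+ j) ^+ K)) =
   ((N.*2.+1)%:R * 2^-1 ^+ j) ^+ K * nu%:R * rho ^+ j :> R.
  by rewrite natrX exprMn; ring.
apply: ler_wpM2r; first by rewrite exprn_ge0 // ltW.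
apply: ler_wpM2r => //; rewrite natrX; apply: lerXn2r; rewrite ?nnegrE //.
rewrite exprVn ler_pdivrMr ?exprn_gt0 // -natrX -natrM ler_nat -/N.
have : (0 < N)%N by rewrite expn_gt0.
by rewrite -addnn; lia.
Qed.

(** A graph point outside [kept_set] is bad at the level where its code is covered, and the bounds
    of [bad_le] form a geometric series. *)
Lemma not_kept_le :
  node_cover mu i (fun t c => exists x,
    (forall j, cube r (mkseq c j) x) /\ B (row_mx t x)) U ->
  (lambda [set t | T1 t /\ [/\ B (row_mx t (f t)), cube r [::] (f t) &
      ~ kept_set (row_mx t (f t))]] <=
    ((3 ^ K * nu)%:R * rho ^+ i / (1 - rho))%:E)%E.
Proof.
move=> [U0 _ cU].
apply: (@le_trans _ _ (lambda (\bigcup_j bad (i + j)%N))).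
  apply: le_outer_measure => t [T1t [Bt ft nk]].
  have [c Hc] := code_ex ft.
  have [j Uj] : exists j, U (mkseq c j) t by apply: cU; exists (f t).
  have ij : (i <= j)%N.
    rewrite leqNgt; apply/negP => ji; have := U0 (mkseq c j).
    by rewrite size_mkseq => /(_ ji) Ue; rewrite Ue in Uj.
  exists (j - i)%N => //; rewrite subnKC //; split=> //.
  exists (mkseq c j), [ffun l => Num.floor (t ord0 l / h j)].
  have zt := cell_ex t (h_gt0 j).
  split=> //; rewrite ?size_mkseq // => kz; apply: nk.
  exists (mkseq c j) => //; exists [ffun l => Num.floor (t ord0 l / h j)] => //.
  rewrite /piece ifT; last exact/asboolP.
  by rewrite /= row_mxKl row_mxKr size_mkseq.
apply: (le_trans (outer_measure_sigma_subadditive _ _)).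
rewrite -nneseries_geometric //; apply: lee_nneseries => j _.
  by rewrite outer_measure_ge0.
by apply: (le_trans (bad_le (leq_addr j i))); rewrite exprD mulrA.
Qed.

End kept.

(** [B'] is the lower limit of the kept sets of covers of weight at most [2^-i]. Each intersection
    of a tail lies in kept sets of arbitrarily small premeasure. A graph point outside [B'] is
    missed at infinitely many stages, which Borel-Cantelli allows only for a null set of
    parameters. *)
Lemma stage : exists B' : set 'rV[R]_(K + n),
  hausdorff_measure (K%:R + s') B' = 0%E /\
  forall (f : 'rV[R]_K -> 'rV[R]_n) (lip : nat),
    (forall (t t' : 'rV[R]_K) (d : R), 0 <= d -> (forall j, `|t ord0 j - t' ord0 j| <= d) ->
      forall l, `|f t ord0 l - f t' ord0 l| <= lip%:R * d) ->
    lambda [set t | T1 t /\ [/\ B (row_mx t (f t)), cube r [::] (f t) &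
      ~ B' (row_mx t (f t))]] = 0%E.
Proof.
have h2 i : 0 < 2^-1 ^+ i :> R by rewrite exprn_gt0 // invr_gt0.
have /choice[U HU] := fun i => stage_cover i (h2 i).
pose B_ i := kept_set i (U i).
exists (\bigcup_N \bigcap_(i in [set i | (N <= i)%N]) B_ i); split.
  apply: hausdorff_null_bigcup => N; apply/hausdorff_null => delta d0.
  apply/eqP; rewrite eq_le premeasure_ge0 andbT.
  apply/lee_addgt0Pr => e e0; rewrite add0e.
  set q := Num.sqrt (K + n)%:R * (2 * r); set C := q `^ (K%:R + s').
  have q0 : 0 <= q by rewrite mulr_ge0 ?sqrtr_ge0 // mulr_ge0 // ltW.
  have C0 : 0 <= C by exact: powR_ge0.
  have q1 : 0 < q + 1 by rewrite ltr_wpDl.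
  have C1 : 0 < C + 1 by rewrite ltr_wpDl.
  (* The first bound makes the pieces smaller than [delta], the second makes the premeasure at most
     [e]. *)
  have m0 : 0 < Num.min (delta / (q + 1)) (e / (C + 1)) by rewrite lt_min !divr_gt0.
  have h01 : 0 <= 2^-1 :> R by rewrite invr_ge0.
  have h11 : 2^-1 < 1 :> R by rewrite invf_lt1 // ltr1n.
  have [i Ni] := expr_small N h01 h11 m0.
  rewrite le_min !ler_pdivlMr // => /andP[id ie].
  have hi := ltW (h2 i).
  apply: (@le_trans _ _ (hausdorff_premeasure (K%:R + s') delta (B_ i))).
    by apply: le_premeasure => y; exact.
  apply: (le_trans (kept_premeasure d0 _ (HU i).2)).
    by rewrite -/q; nra.
  by rewrite lee_fin -/q -/C; nra.
move=> f lip f_lip; apply/eqP; rewrite eq_le outer_measure_ge0 andbT.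
apply/lee_addgt0Pr => e e0; rewrite add0e.
case/andP: rho01 => rho_ge0 rho_lt1.
set D : R := (3 ^ K * (lip.+1.*2.+1 ^ n))%:R.
have D0 : 0 <= D by [].
have r1 : 0 < 1 - rho by rewrite subr_gt0.
(* One division by [1 - rho] comes from the sum over levels in [not_kept_le], the other from the sum
   over stages. *)
have E1 : 0 < D / (1 - rho) / (1 - rho) + 1 by rewrite ltr_wpDl // !divr_ge0 // ltW.
have [N _ HN] := expr_small 0 rho_ge0 rho_lt1 (divr_gt0 e0 E1).
pose Z i : set 'rV[R]_K := [set t | T1 t /\ [/\ B (row_mx t (f t)),
  cube r [::] (f t) & ~ B_ i (row_mx t (f t))]].
apply: (@le_trans _ _ (lambda (\bigcup_i Z (N + i)%N))).
  apply: le_outer_measure => t [T1t [Bt ft nB]].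
  apply: contrapT => nZ; apply: nB; exists N => // i /= Ni.
  apply: contrapT => nBi; apply: nZ; exists (i - N)%N => //.
  by rewrite subnKC.
apply: (le_trans (outer_measure_sigma_subadditive _ _)).
apply: (@le_trans _ _ (\sum_(0 <= i <oo) ((D * rho ^+ N / (1 - rho)) * rho ^+ i)%:E)%E).
  apply: lee_nneseries => i _; first by rewrite outer_measure_ge0.
  apply: (le_trans (not_kept_le f_lip (HU (N + i)%N).1)).
  by rewrite lee_fin -/D exprD mulrA (mulrAC _ _ (_^-1)).
rewrite nneseries_geometric // lee_fin.
have -> : D * rho ^+ N / (1 - rho) / (1 - rho) = rho ^+ N * (D / (1 - rho) / (1 - rho)) by ring.
apply: (@le_trans _ _ (rho ^+ N * (D / (1 - rho) / (1 - rho) + 1))).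
  by rewrite ler_wpM2l ?exprn_ge0 // lerDl.
by rewrite -ler_pdivlMr.
Qed.

End stage.

(** * Conclusion *)

Lemma hausdorff_null_le (R : realType) (n : nat) (s s' : R) (A : set 'rV[R]_n) :
  0 <= s <= s' -> hausdorff_measure s A = 0%E -> hausdorff_measure s' A = 0%E.
Proof.
move=> /andP[s0 ss'] /hausdorff_null HA; apply/hausdorff_null => delta d0.
apply/eqP; rewrite eq_le premeasure_ge0 andbT.
(* For pieces of diameter at most 1, the gauge does not increase with the exponent. *)
have m0 : 0 < Num.min delta 1 by rewrite lt_min d0 ltr01.
rewrite -(HA _ m0); apply: le_ereal_inf_tmp => _ [U [Ud AU] <-].
have Ud1 i : (diam (U i) <= 1%:E)%E.
  by apply: (le_trans (Ud i)); rewrite lee_fin ge_min lexx orbT.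
apply: ereal_inf_le; exists (\sum_(0 <= i <oo) hausdorff_gauge s' (U i))%E.
  exists U => //; split=> // i; apply: (le_trans (Ud i)).
  by rewrite lee_fin ge_min lexx.
apply: lee_nneseries => i _; first by rewrite gauge_ge0.
rewrite /hausdorff_gauge; case: ifP => // _.
have dU : diam (U i) = (fine (diam (U i)))%:E.
  by rewrite fineK // ge0_fin_numE ?diam_ge0 // (le_lt_trans (Ud1 i)) ?ltry.
have := Ud1 i; have := diam_ge0 (U i); rewrite dU !lee_fin.
set d := fine _; rewrite le_eqVlt => /predU1P[<- _|d1 d2]; last first.
  by apply: ger_powR; rewrite ?d1.
(* A piece of diameter 0 has gauge 1 for exponent 0, so [s' = 0] is treated apart; then [s = 0] as
   well. *)
have [s'E|s'0] := eqVneq s' 0.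
  have -> : s = 0 by apply/le_anti; rewrite s0 -s'E ss'.
  by rewrite s'E.
by rewrite powR0 // powR_ge0.
Qed.

Lemma outer_null_bigcup (R : realType) (T : Type) (mu : {outer_measure set T -> \bar R})
    (K : countType) (A : K -> set T) :
  (forall z, mu (A z) = 0%E) -> mu (\bigcup_z A z) = 0%E.
Proof.
move=> A0; pose A' n := if @unpickle K n is Some z then A z else set0.
apply/eqP; rewrite eq_le outer_measure_ge0 andbT.
apply: (@le_trans _ _ (mu (\bigcup_n A' n))).
  by apply: le_outer_measure => x [z _ Ax]; exists (pickle z) => //; rewrite /A' pickleK.
apply: (le_trans (outer_measure_sigma_subadditive _ _)).
rewrite eseries0 // => n _ _; rewrite /A'; case: unpickle => // z; exact: A0.
Qed.

(** Non-verticality lifts each basis vector of the base to a direction [v i] of [P]. Combining these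
    lifts linearly from [p] gives an affine map, and the sum of the absolute values of their
    vertical coordinates bounds its Lipschitz constant. *)
Lemma non_vertical_graph (R : realType) (k n : nat) (P : set 'rV[R]_(k + n)) :
  affine_subspaces k P -> non_vertical P ->
  exists (f : 'rV[R]_k -> 'rV[R]_n) (lip : nat),
    (forall t, P (row_mx t (f t))) /\
    forall (t t' : 'rV[R]_k) (d : R), 0 <= d ->
      (forall j, `|t ord0 j - t' ord0 j| <= d) ->
      forall l, `|f t ord0 l - f t' ord0 l| <= lip%:R * d.
Proof.
move=> [p [V [_ PV]]] nvP.
have /choice[v Hv] : forall i : 'I_k, exists v, v \in V /\ lsubmx v = delta_mx ord0 i.
  move=> i; have : [set row_mx t 0 | t in [set: 'rV[R]_k]]
      (row_mx (lsubmx p + delta_mx ord0 i) 0 : 'rV[R]_(k + n)).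
    by exists (lsubmx p + delta_mx ord0 i).
  rewrite -nvP PV => -[_ [v /= vV <-]] /(congr1 lsubmx).
  rewrite /horizontal_proj !row_mxKl linearD => /addrI vi.
  by exists v.
pose f t := rsubmx p + \sum_i (t - lsubmx p) ord0 i *: rsubmx (v i).
have sumV t : \sum_i (t - lsubmx p) ord0 i *: v i \in V.
  by apply: rpred_sum => i _; apply: rpredZ; case: (Hv i).
pose M := \sum_i \sum_l `|rsubmx (v i) ord0 l|.
have M0 : 0 <= M by apply: sumr_ge0 => i _; apply: sumr_ge0.
exists f, (Num.bound M); split=> [t|t t' d d0 tt' l].
  rewrite PV; exists (\sum_i (t - lsubmx p) ord0 i *: v i); first exact: sumV.
  rewrite -[LHS]hsubmxK !linearD !linear_sum /=; congr row_mx.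
    under eq_bigr do rewrite linearZ /= (Hv _).2.
    by rewrite -row_sum_delta addrC subrK.
  by congr (_ + _); apply: eq_bigr => i _; rewrite linearZ.
have -> : f t ord0 l - f t' ord0 l =
    \sum_i (t ord0 i - t' ord0 i) * rsubmx (v i) ord0 l.
  rewrite /f !mxE opprD addrACA subrr add0r !summxE -sumrB.
  by apply: eq_bigr => i _; rewrite !mxE; ring.
apply: (le_trans (ler_norm_sum _ _ _)).
apply: (@le_trans _ _ (\sum_i d * \sum_l `|rsubmx (v i) ord0 l|)).
  apply: ler_sum => i _; rewrite normrM; apply: ler_pM => //.
  by rewrite (bigD1 l) //= lerDl sumr_ge0.
rewrite -mulr_sumr mulrC ler_wpM2r //.
exact: ltW (archi_boundP M0).
Qed.

Lemma exists_nat_bound (R : realType) (p : nat) (x : 'rV[R]_p) :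
  exists N : nat, forall j, `|x ord0 j| <= N.+1%:R.
Proof.
pose M := \sum_j `|x ord0 j|; have M0 : 0 <= M by apply: sumr_ge0.
exists (Num.bound M) => j; apply: (@le_trans _ _ M).
  by rewrite /M (bigD1 j) //= lerDl sumr_ge0.
apply: ltW; apply: (lt_trans (archi_boundP M0)).
by rewrite ltr_nat.
Qed.

Lemma slices_lower_bound (R : realType) (k n : nat) (E : set (set 'rV[R]_(k.+1 + n))) :
  E `<=` affine_subspaces k.+1 -> (forall P, E P -> non_vertical P) ->
  borel (\bigcup_(P in E) P) ->
  lebesgue_ae (fun t : 'rV[R]_k.+1 =>
    (rdim k.+1 E <= hausdorff_dim (slice (\bigcup_(P in E) P) t))%E).
Proof.
move=> EA Ev bB; rewrite /lebesgue_ae; set B := \bigcup_(P in E) P.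
pose lambda : {outer_measure set 'rV[R]_k.+1 -> \bar R} := @lebesgue_outer R k.+1.
(* Rational exponents write the exceptional set as a countable union. *)
pose T (q : rat * rat) : set 'rV[R]_k.+1 := [set t | [/\ 0 < ratr q.1 :> R,
  ratr q.1 < ratr q.2 :> R, ((ratr q.2)%:E < rdim k.+1 E)%E &
  hausdorff_measure (ratr q.1) (slice B t) = 0%E]].
suff T0 q : lambda (T q) = 0%E.
  apply/eqP; rewrite eq_le (outer_measure_ge0 lambda) andbT.
  rewrite -(outer_null_bigcup T0); apply: (le_outer_measure lambda) => t /negP.
  rewrite -ltNge => /ereal_inf_lt[_ [s [s0 Hs] <-] sr].
  (* A real bound is interposed because [rdim] may be infinite. *)
  have [b sb br] : exists2 b : R, s < b & (b%:E <= rdim k.+1 E)%E.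
    move: sr; case: (rdim k.+1 E) => [x| |] //; first by rewrite lte_fin; exists x.
    by exists (s + 1); rewrite ?ltrDl ?leey.
  have [q /[!in_itv]/= /andP[sq qb]] := rat_in_itvoo sb.
  have [q' /[!in_itv]/= /andP[qq' q'b]] := rat_in_itvoo qb.
  exists (q, q') => //; split=> //=; first exact: le_lt_trans sq.
    by apply: lt_le_trans br; rewrite lte_fin.
  by apply: hausdorff_null_le Hs; rewrite s0 ltW.
have [[q0 qq' qr]|nq] := pselect [/\ 0 < ratr q.1 :> R, ratr q.1 < ratr q.2 :> R &
    ((ratr q.2)%:E < rdim k.+1 E)%E]; last first.
  rewrite (_ : T q = set0) ?outer_measure0 //.
  by apply/seteqP; split=> // t [*]; apply: nq.
have nullT t : T q t -> hausdorff_measure (ratr q.1) (slice B t) = 0%E by case.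
have /choice[B' HB'] := fun N => stage (ltr0Sn R N) q0 qq' bB nullT.
(* If [T q] is not null, the union of the [B' N], over the boxes of half-width [N + 1], competes in
   the infimum [rdim] and forces it below [ratr q.2]. *)
apply: contrapT => Tn0; move: qr; apply/negP; rewrite -leNgt.
have B'0 : hausdorff_measure (k.+1%:R + ratr q.2) (\bigcup_N B' N) = 0%E.
  by apply: hausdorff_null_bigcup => N; case: (HB' N).
apply: (@le_trans _ _ (hausdorff_dim (\bigcup_N B' N) - k.+1%:R%:E)%E); last first.
  rewrite leeBlDr // -EFinD addrC; apply: ereal_inf_lbound.
  by exists (k.+1%:R + ratr q.2) => //; split=> //; rewrite addr_ge0 // ltW // (lt_trans q0).
apply: ereal_inf_lbound; exists (\bigcup_N B' N) => // P EP.
rewrite lt_neqAle hausdorff_measure_ge0 andbT; apply/eqP => /esym BP0; apply: Tn0.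
have [f [lip [Pf f_lip]]] := non_vertical_graph (EA _ EP) (Ev _ EP).
(* If the union met [P] in a null set, its projection would be null; the rest of [T q] lies in the
   null sets [Z N], so [T q] itself would be null. *)
pose Z N := [set t | (T q t /\ forall j, `|t ord0 j| <= N.+1%:R) /\
  [/\ B (row_mx t (f t)), cube N.+1%:R [::] (f t) & ~ B' N (row_mx t (f t))]].
have Z0 N : lambda (Z N) = 0%E by exact: (HB' N).2 f_lip.
apply/eqP; rewrite eq_le outer_measure_ge0 andbT.
apply: (@le_trans _ _ (lambda ([set lsubmx x | x in (\bigcup_N B' N) `&` P] `|`
    \bigcup_N Z N))).
  apply: le_outer_measure => t Tt.
  have [N tN] := exists_nat_bound t; have [M fM] := exists_nat_bound (f t).
  have [B't|nB't] := pselect (B' (maxn N M) (row_mx t (f t))); [left|right].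
    exists (row_mx t (f t)); last by rewrite row_mxKl.
    by split; [exists (maxn N M)|exact: Pf].
  exists (maxn N M) => //; split.
    by split=> // j; rewrite (le_trans (tN j)) // ler_nat ltnS leq_maxl.
  split=> //; first by exists P => //; exact: Pf.
  apply/cube0P => j.
  by rewrite (le_trans (fM j)) // ler_nat ltnS leq_maxr.
apply: (le_trans (outer_measureU2 _ _ _)).
rewrite (outer_null_bigcup Z0) adde0.
by rewrite (lebesgue_null_proj BP0 : lambda _ = 0%E).
Qed.

Theorem corollary3p4 (R : realType) (k m : nat) (hk : (1 <= k)%N)
  (hkm : (k < m)%N) (E : set (set 'rV[R]_(k + (m - k))))
  (hE0 : E !=set0)
  (hEA : E `<=` affine_subspaces k)
  (hEv : forall P, E P -> non_vertical P)
  (hB : borel (\bigcup_(P in E) P)) :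
  lebesgue_ae (fun t : 'rV[R]_k =>
    (rdim k E <= hausdorff_dim (slice (\bigcup_(P in E) P) t))%E).
Proof.
case: k hk hkm E hE0 hEA hEv hB => // k _ _ E _ hEA hEv hB.
exact: slices_lower_bound.
Qed.
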